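(* For all integers $n\geq0$ and $\alpha\geq1$, \begin{align*} p_{-6}\left(5^{\alpha}n+\frac{3\cdot5^{\alpha}+1}{4}\right)&\equiv0\pmod{5^{\alpha}},\\ p_{-6}\left(5^{\alpha+1}n+\frac{11\cdot5^{\alpha}+1}{4}\right)&\equiv0\pmod{5^{\alpha+1}},\\ p_{-6}\left(5^{\alpha+1}n+\frac{19\cdot5^{\alpha}+1}{4}\right)&\equiv0\pmod{5^{\alpha+1}}. \end{align*}
   Context: $p_{-6}(n)$ is the number of $6$-colored partitions of $n$, i.e. $\sum_{n\geq0}p_{-6}(n)q^n=\prod_{i\geq1}(1-q^i)^{-6}$. *)

(* Defs.v *)
From mathcomp Require Import all_boot all_order all_algebra.

Set Implicit Arguments.
Unset Strict Implicit.
Unset Printing Implicit Defensive.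

Import GRing.Theory.

(* A k-colored partition of n is a finite multiset of pairs (color, part) whose
   parts add up to n.  It is encoded by its multiplicity function: [m (c, i)] is
   the number of parts of size [i.+1] and color [c].  In a partition of n, part
   sizes and multiplicities are at most n, hence the finite domain and range. *)
Definition colored_partitions (k n : nat) :
    {set {ffun 'I_k * 'I_n -> 'I_n.+1}} :=
  [set m : {ffun 'I_k * 'I_n -> 'I_n.+1} | \sum_x m x * x.2.+1 == n].

(* [p_minus k n] is the number usually written p_{-k}(n). *)
Definition p_minus (k n : nat) : nat := #|colored_partitions k n|.

Local Open Scope ring_scope.

Section GeneratingFunction.

Variable k : nat.

Let agree (n : nat) (a b : {poly int}) := forall j, (j <= n)%N -> a`_j = b`_j.

Let agreeM n a b c d : agree n a b -> agree n c d -> agree n (a * c) (b * d).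
Proof.
move=> hab hcd j lejn; rewrite !coefM; apply: eq_bigr => i _.
have leij : (i <= j)%N by rewrite -ltnS.
rewrite hab ?hcd //; first exact: leq_trans (leq_subr _ _) lejn.
exact: leq_trans leij lejn.
Qed.

Let agree_sym n a b : agree n a b -> agree n b a.
Proof. by move=> h j /h. Qed.

Let agree_trans n b a c : agree n a b -> agree n b c -> agree n a c.
Proof. by move=> h h' j lej; rewrite h ?h'. Qed.

Let agree_prod1 n (I : Type) (r : seq I) (P : pred I) (F : I -> {poly int}) :
  (forall i, P i -> agree n (F i) 1) -> agree n (\prod_(i <- r | P i) F i) 1.
Proof.
move=> h; apply: (big_ind (fun a => agree n a 1)) => // a b ha hb.
by rewrite -[X in agree _ _ X]mulr1; apply: agreeM.
Qed.

Let agree_exp1 n a m : agree n a 1 -> agree n (a ^+ m) 1.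
Proof.
move=> h; elim: m => [|m IHm] //.
by rewrite exprS -[X in agree _ _ X]mulr1; apply: agreeM.
Qed.

Let G n : {poly int} :=
  \prod_(x : 'I_k * 'I_n) \sum_(j < n.+1) 'X^(j * x.2.+1).

Let E N : {poly int} := \prod_(x : 'I_k * 'I_N) (1 - 'X^(x.2.+1)).

Let coefG n : (G n)`_n = (p_minus k n)%:R.
Proof.
rewrite /G bigA_distr_bigA /= coef_sum /p_minus /colored_partitions.
rewrite -sum1dep_card natr_sum [RHS]big_mkcond /=.
apply: eq_bigr => m _; rewrite prodrXr coefXn eq_sym.
by case: eqP.
Qed.

Let geom_agree n i : agree n ((1 - 'X^(i.+1)) * \sum_(j < n.+1) 'X^(j * i.+1)) 1.
Proof.
move=> j lejn.
have -> : \sum_(j0 < n.+1) 'X^(j0 * i.+1) = \sum_(j0 < n.+1) ('X^(i.+1)) ^+ j0 :> {poly int}.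
  by apply: eq_bigr => l _; rewrite -exprM mulnC.
rewrite -opprB mulNr -subrX1 opprB -exprM coefB coefXn.
case: eqP => [ej|_]; last by rewrite subr0.
by move: lejn; rewrite ej mulSn leqNgt ltnS leq_addr.
Qed.

Let EG n N : (n <= N)%N -> agree n (E N * G n) 1.
Proof.
move=> lenN.
have prodE M (F : nat -> {poly int}) :
    \prod_(x : 'I_k * 'I_M) F x.2 = \prod_(0 <= i < M) F i ^+ k.
  rewrite -(pair_bigA _ (fun (c : 'I_k) (i : 'I_M) => F i)) /= exchange_big /= big_mkord.
  by apply: eq_bigr => i _; rewrite prodr_const card_ord.
rewrite /E /G (prodE _ (fun i => 1 - 'X^(i.+1))).
rewrite (prodE _ (fun i => \sum_(j < n.+1) 'X^(j * i.+1))).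
rewrite (big_cat_nat (n := n)) //= mulrAC -big_split /= -[X in agree _ _ X]mulr1.
apply: agreeM.
  apply: agree_prod1 => i _; rewrite -exprMn.
  exact/agree_exp1/geom_agree.
rewrite big_nat; apply: agree_prod1 => i /andP[leni _].
apply: agree_exp1 => j lejn.
rewrite coefB coefXn; case: eqP => [ej|_]; last by rewrite subr0.
by have := leq_trans lejn leni; rewrite ej ltnn.
Qed.

(* Coefficientwise form of
     \prod_(i >= 1) (1 - q^i)^k * \sum_(n >= 0) p_{-k}(n) q^n = 1 :
   factors with i > N and terms with n > N do not affect the coefficients of
   index at most N. *)
Lemma p_minus_gf (N j : nat) : (j <= N)%N ->
  ((\prod_(1 <= i < N.+1) (1 - 'X^i) ^+ k)
   * \poly_(n < N.+1) (p_minus k n)%:R : {poly int})`_j = (j == 0)%:R.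
Proof.
move=> lejN.
have -> : \prod_(1 <= i < N.+1) (1 - 'X^i) ^+ k = E N.
  rewrite /E -(pair_bigA _ (fun (c : 'I_k) (i : 'I_N) => 1 - 'X^(i.+1))) /=.
  rewrite exchange_big /= big_add1 /= big_mkord.
  by apply: eq_bigr => i _; rewrite prodr_const card_ord.
have GG n : (n <= N)%N -> agree n (G N) (G n).
  move=> lenN.
  have h1 : agree n (E N * G N) 1.
    by move=> i lei; apply: EG => //; apply: leq_trans lei lenN.
  apply: (agree_trans (b := G n * (E N * G N))).
    rewrite mulrA -{1}[G N]mul1r; apply: agreeM => //.
    by rewrite mulrC; apply/agree_sym/EG.
  by rewrite -{2}[G n]mulr1; apply: agreeM.
rewrite -coef1; apply: (agree_trans (b := E N * G N)) lejN; last exact: EG.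
apply: agreeM => // i lei; rewrite coef_poly ltnS lei -coefG.
exact/esym/GG.
Qed.

End GeneratingFunction.

(* Main.v *)
(** The generating function of the 6-colored partitions is E^-6, where
    E = prod_(i >= 1) (1 - q^i).  Let U keep the coefficients of index divisible
    by 5 and let T = q E(q^5)^6 / E(q)^6.  For c_a n = p_(-6) (5^a n + (3 5^a + 1)/4)
    one has q sum_n c_a(n) q^n = E^-6 L_a with L_1 = U T and L_(a+1) = U (T L_a).

    Each U (T^i) is a polynomial in T.  Indeed E = A - q E(q^25) + q^2 C with A, C
    series in q^5 (pentagonal numbers), A C = - E(q^25)^2 (Jacobi's identity for
    E^3 has no exponents congruent to 2 mod 5), and the product of the conjugates
    E(zeta q), zeta^5 = 1, is E(q^5)^6 / E(q^25).  This gives the modular equation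
    xi^5 = T(q^5) (1 + 5 xi + 15 xi^2 + 25 xi^3 + 25 xi^4) for xi = q E(q^25)/E(q),
    and T = xi^6 / T(q^5).  The 5-adic valuations of 5, 15, 25, 25 make the
    coefficient of T^j in L_a divisible by 5^(a + floor((5j - 5)/2)), which is the
    first congruence.  Modulo 5^(a+1) only the term in T^1 remains; it contributes
    a multiple of E(q^5)^6 E^-12, which mod 5 is E^3 times a series in q^5, and E^3
    has no exponents congruent to 2 or 4 mod 5. *)

Require Import Defs.
From HB Require Import structures.
From mathcomp Require Import all_boot all_order all_algebra all_field.
From mathcomp Require Import boolp ring zify.

Set Implicit Arguments.
Unset Strict Implicit.
Unset Printing Implicit Defensive.

Import GRing.Theory.
Local Open Scope ring_scope.

(** * Formal power series *)

(** Series are bare coefficient functions, so equality is checked coefficientwise through the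
    extensionality of [boolp]. The ring stays general because [int] and [algC] both serve as
    coefficients. *)
Definition fps (R : comNzRingType) := nat -> R.

Section FpsRing.
Variable R : comNzRingType.
Implicit Types f g h : fps R.

Definition trunc N f : {poly R} := \poly_(i < N.+1) f i.

Lemma coef_trunc N f i : (i <= N)%N -> (trunc N f)`_i = f i.
Proof. by move=> iN; rewrite coef_poly ltnS iN. Qed.

Definition fps_add f g : fps R := fun n => f n + g n.
Definition fps_opp f : fps R := fun n => - f n.
Definition fps_zero : fps R := fun=> 0.
Definition fps_one : fps R := fun n => (n == 0)%:R.
Definition fps_mul f g : fps R := fun n => \sum_(i < n.+1) f i * g (n - i)%N.

Lemma coefM_agree N (p q : {poly R}) f g :
  (forall i, (i <= N)%N -> p`_i = f i) -> (forall i, (i <= N)%N -> q`_i = g i) ->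
  (p * q)`_N = fps_mul f g N.
Proof.
move=> pf qg; rewrite coefM; apply: eq_bigr => i _.
by rewrite pf ?qg // ?leq_subr // -ltnS.
Qed.

(** A coefficient of a product involves only coefficients of smaller or equal index; the ring axioms
    are thereby inherited from polynomials. *)
Lemma fps_mulE N n f g : (n <= N)%N -> fps_mul f g n = (trunc N f * trunc N g)`_n.
Proof.
by move=> nN; apply/esym/coefM_agree => i ni; rewrite coef_trunc // (leq_trans ni).
Qed.

Lemma fps_addA : associative fps_add.
Proof. by move=> f g h; apply/funext => n; apply: addrA. Qed.
Lemma fps_addC : commutative fps_add.
Proof. by move=> f g; apply/funext => n; apply: addrC. Qed.
Lemma fps_add0 : left_id fps_zero fps_add.
Proof. by move=> f; apply/funext => n; apply: add0r. Qed.
Lemma fps_addN : left_inverse fps_zero fps_opp fps_add.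
Proof. by move=> f; apply/funext => n; apply: addNr. Qed.

HB.instance Definition _ := gen_eqMixin (fps R).
HB.instance Definition _ := gen_choiceMixin (fps R).
HB.instance Definition _ :=
  GRing.isZmodule.Build (fps R) fps_addA fps_addC fps_add0 fps_addN.

Lemma fps_mulC : commutative fps_mul.
Proof. by move=> f g; apply/funext => n; rewrite !(fps_mulE _ _ (leqnn n)) mulrC. Qed.
Lemma fps_mulA : associative fps_mul.
Proof.
move=> f g h; apply/funext => n.
transitivity (trunc n f * (trunc n g * trunc n h))`_n.
  apply/esym/coefM_agree => i ni; first exact: coef_trunc.
  by rewrite -fps_mulE.
rewrite mulrA; apply: coefM_agree => i ni; last exact: coef_trunc.
by rewrite -fps_mulE.
Qed.
Lemma fps_mul1 : left_id fps_one fps_mul.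
Proof.
move=> f; apply/funext => n; rewrite -[RHS](coef_trunc f (leqnn n)) -[trunc n f]mul1r.
by apply/esym/coefM_agree => i ni; rewrite ?coef1 ?coef_trunc.
Qed.
Lemma fps_mulD : left_distributive fps_mul fps_add.
Proof.
move=> f g h; apply/funext => n; rewrite /fps_mul /fps_add -big_split /=.
by apply: eq_bigr => i _; rewrite mulrDl.
Qed.
Lemma fps_one_neq0 : fps_one != fps_zero.
Proof.
by apply/eqP => /(congr1 (@^~ 0%N)); rewrite /fps_one eqxx => /eqP; rewrite oner_eq0.
Qed.

HB.instance Definition _ :=
  GRing.Zmodule_isComNzRing.Build (fps R) fps_mulA fps_mulC fps_mul1 fps_mulD fps_one_neq0.

Lemma fpsD f g n : (f + g) n = f n + g n. Proof. by []. Qed.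
Lemma fpsN f n : (- f) n = - f n. Proof. by []. Qed.
Lemma fps0 n : (0 : fps R) n = 0. Proof. by []. Qed.
Lemma fps1 n : (1 : fps R) n = (n == 0)%:R. Proof. by []. Qed.
Lemma fpsM f g n : (f * g) n = \sum_(i < n.+1) f i * g (n - i)%N. Proof. by []. Qed.
Lemma fpsMtrunc N f g n : (n <= N)%N -> (f * g) n = (trunc N f * trunc N g)`_n.
Proof. exact: fps_mulE. Qed.

Lemma fps_sum I (r : seq I) (Q : pred I) (F : I -> fps R) n :
  (\sum_(i <- r | Q i) F i) n = \sum_(i <- r | Q i) F i n.
Proof. exact: (big_morph (fun f => f n) (fun f g => fpsD f g n) (fps0 n)). Qed.

Lemma fpsMn f m n : (f *+ m) n = f n *+ m.
Proof. by elim: m => [|m IH]; rewrite ?mulr0n // !mulrS fpsD IH. Qed.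

Lemma fpsMz f (m : int) n : (f *~ m) n = f n *~ m.
Proof. by case: m => m; rewrite /intmul ?fpsN fpsMn. Qed.

Lemma fpsMintr f (m : int) n : (m%:~R * f) n = m%:~R * f n.
Proof. by rewrite !mulrzl fpsMz. Qed.

Definition fX : fps R := fun n => (n == 1)%:R.

Lemma fXM f n : (fX * f) n = if n is n'.+1 then f n' else 0.
Proof.
rewrite fpsM; case: n => [|n]; first by rewrite big_ord1 mul0r.
rewrite !big_ord_recl /= mul0r add0r mul1r big1 ?addr0; last by move=> i _; rewrite mul0r.
by rewrite subSS subn0.
Qed.

Lemma fXnM m f n : (fX ^+ m * f) n = if (n < m)%N then 0 else f (n - m)%N.
Proof.
elim: m n => [|m IH] n; first by rewrite mul1r subn0.
by rewrite exprS -mulrA fXM; case: n => [|n] //; rewrite IH ltnS subSS.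
Qed.

Lemma fXn m n : (fX ^+ m) n = (n == m)%:R.
Proof. by rewrite -[fX ^+ m]mulr1 fXnM fps1 subn_eq0 eqn_leq; case: ltngtP. Qed.

Lemma fXnI m : injective (fun f : fps R => fX ^+ m * f).
Proof.
move=> f g /(congr1 (fun h : fps R => h (_ + m)%N)) e; apply/funext => n.
by have := e n; rewrite !fXnM ltnNge leq_addl addnK.
Qed.

(** Congruence modulo q^(N+1), which stands in for limits of infinite products. *)
Definition agree N f g := forall n, (n <= N)%N -> f n = g n.

Lemma agreeM N f f' g g' : agree N f f' -> agree N g g' -> agree N (f * g) (f' * g').
Proof.
move=> ff gg n nN; rewrite !fpsM; apply: eq_bigr => i _.
have iN : (i <= n)%N by rewrite -ltnS.
by rewrite ff ?(leq_trans iN) // gg // (leq_trans (leq_subr _ _)).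
Qed.

Lemma agree_refl N f : agree N f f. Proof. by []. Qed.

Lemma agree_trans N g f h : agree N f g -> agree N g h -> agree N f h.
Proof. by move=> fg gh n nN; rewrite fg ?gh. Qed.

Lemma agree_sym N f g : agree N f g -> agree N g f.
Proof. by move=> fg n nN; rewrite fg. Qed.

Lemma agreeD N f f' g g' : agree N f f' -> agree N g g' -> agree N (f + g) (f' + g').
Proof. by move=> ff gg n nN; rewrite !fpsD ff ?gg. Qed.

Lemma agree_sum N I (r : seq I) (Q : pred I) (F G : I -> fps R) :
  (forall i, Q i -> agree N (F i) (G i)) ->
  agree N (\sum_(i <- r | Q i) F i) (\sum_(i <- r | Q i) G i).
Proof. by move=> FG n nN; rewrite !fps_sum; apply: eq_bigr => i /FG ->. Qed.

Lemma agreeX N f g m : agree N f g -> agree N (f ^+ m) (g ^+ m).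
Proof. by move=> fg; elim: m => [|m IH] //; rewrite !exprS; apply: agreeM. Qed.

Lemma agree_fXnM N m f g k : agree k f g -> (N <= k + m)%N ->
  agree N (fX ^+ m * f) (fX ^+ m * g).
Proof.
move=> fg Nkm n nN; rewrite !fXnM; case: ltnP => // mn.
by apply: fg; rewrite leq_subLR addnC (leq_trans nN).
Qed.

Lemma agree_fXn0 N m f : (N < m)%N -> agree N (fX ^+ m * f) 0.
Proof. by move=> Nm n nN; rewrite fXnM (leq_ltn_trans nN Nm). Qed.

Lemma fps_reg f g : f 0%N = 1 -> f * g = 0 -> g = 0.
Proof.
move=> f0 fg0; apply/funext => n; elim/ltn_ind: n => n IH.
have := congr1 (fun h : fps R => h n) fg0.
rewrite fpsM big_ord_recl f0 mul1r subn0 big1 ?addr0 // => i _.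
by rewrite IH ?fps0 ?mulr0 // lift0; have := ltn_ord i; lia.
Qed.

(* [phi f] is f(q^5); [sect r f] has n-th coefficient that of q^(5n+r), so U is [sect 0]. *)
Definition phi f : fps R := fun n => if (5 %| n)%N then f (n %/ 5)%N else 0.
Definition sect r f : fps R := fun n => f (5 * n + r)%N.

Lemma phi_nmod : nmod_morphism phi.
Proof.
split=> [|f g]; apply/funext => n; rewrite /phi ?fpsD; case: ifP => // _.
by rewrite addr0.
Qed.
HB.instance Definition _ := GRing.isNmodMorphism.Build (fps R) (fps R) phi phi_nmod.

Lemma phi_monoid : monoid_morphism phi.
Proof.
split.
  apply/funext => -[|n] //; rewrite /phi fps1; case: ifP => // /dvdnP[m e].
  by rewrite e mulnK //; case: m e.
move=> f g; apply/funext => n; rewrite (fpsMtrunc _ _ (leqnn n)).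
have tr h : forall i, (i <= n)%N -> (trunc n h \Po 'X^5)`_i = phi h i.
  move=> i ni; rewrite coef_comp_poly_Xn // /phi; case: ifP => // _.
  by rewrite coef_trunc // (leq_trans (leq_div _ _)).
rewrite {1}/phi; transitivity ((trunc n f * trunc n g) \Po 'X^5)`_n.
  rewrite coef_comp_poly_Xn //; case: ifP => // _.
  by rewrite -fpsMtrunc // leq_div.
by rewrite comp_polyM -fpsMtrunc //; apply: coefM_agree; apply: tr.
Qed.
HB.instance Definition _ := GRing.isMonoidMorphism.Build (fps R) (fps R) phi phi_monoid.

Lemma phi_fX : phi fX = fX ^+ 5.
Proof.
apply/funext => n; rewrite fXn /phi /fX; case: ifP => [/dvdnP[m ->]|].
  by rewrite mulnK // -[RHS]/((m * 5 == 1 * 5)%N%:R) eqn_pmul2r.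
by case: eqP => // ->.
Qed.

Lemma agree_phi N f g : agree N f g -> agree N (phi f) (phi g).
Proof.
move=> fg n nN; rewrite /phi; case: ifP => // _.
by apply: fg; rewrite (leq_trans (leq_div _ _)).
Qed.

Lemma sect_nmod r : nmod_morphism (sect r).
Proof. by split. Qed.
HB.instance Definition _ r := GRing.isNmodMorphism.Build (fps R) (fps R) (sect r) (sect_nmod r).

Lemma sect_fXphi r s f : (r < 5)%N -> (s < 5)%N ->
  sect r (fX ^+ s * phi f) = if r == s then f else 0.
Proof.
move=> r5 s5; apply/funext => n; rewrite /sect fXnM /phi.
case: eqP => [->|ne].
  by rewrite ltnNge leq_addl /= addnK dvdn_mulr // mulKn.
case: ltnP => // le; case: ifP => // dv; exfalso; move: dv ne; lia.
Qed.

Lemma sect_sum r f0 f1 f2 f3 f4 : (r < 5)%N ->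
  sect r (phi f0 + fX * phi f1 + fX ^+ 2 * phi f2 + fX ^+ 3 * phi f3 + fX ^+ 4 * phi f4)
  = nth 0 [:: f0; f1; f2; f3; f4] r.
Proof.
move=> r5; rewrite -[phi f0]mul1r -[1]/(fX ^+ 0) -{2}[fX]/(fX ^+ 1) !raddfD /= !sect_fXphi //.
by case: r r5 => [|[|[|[|[|]]]]] //= _; rewrite ?addr0 ?add0r.
Qed.

Lemma sectE f : f = phi (sect 0 f) + fX * phi (sect 1 f) + fX ^+ 2 * phi (sect 2 f)
  + fX ^+ 3 * phi (sect 3 f) + fX ^+ 4 * phi (sect 4 f).
Proof.
set g := RHS; apply/funext => n.
have e r : (r < 5)%N -> sect r g = sect r f.
  by move=> r5; rewrite sect_sum //; case: r r5 => [|[|[|[|[|]]]]].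
have := congr1 (fun h : fps R => h (n %/ 5)%N) (e (n %% 5)%N (@ltn_pmod n 5 isT)).
by rewrite /sect mulnC -divn_eq.
Qed.

Lemma sectM r f g : (r < 5)%N -> sect r (phi f * g) = f * sect r g.
Proof.
move=> r5; rewrite {1}[g]sectE !mulrDr !(mulrCA (phi f)) -!rmorphM sect_sum //.
by case: r r5 => [|[|[|[|[|]]]]].
Qed.

End FpsRing.

(** * Euler's pentagonal number theorem and the 5-dissection of E *)

Section EulerProduct.
Variable R : comNzRingType.
Local Notation q := (fX R).

Definition euler_fin n : fps R := \prod_(1 <= i < n.+1) (1 - q ^+ i).
(** The n-th coefficient is read off after n factors; the later factors no longer change it. *)
Definition euler : fps R := fun n => euler_fin n n.

Lemma euler_finS n : euler_fin n.+1 = euler_fin n * (1 - q ^+ n.+1).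
Proof. by rewrite /euler_fin big_nat_recr. Qed.

Lemma euler_fin0 : euler_fin 0 = 1.
Proof. by rewrite /euler_fin big_geq. Qed.

Lemma euler_fin_agree n m : (n <= m)%N -> agree n (euler_fin m) (euler_fin n).
Proof.
elim: m => [|m IH]; first by rewrite leqn0 => /eqP->.
rewrite leq_eqVlt => /orP[/eqP-> //|nm].
apply: agree_trans (IH nm); rewrite euler_finS mulrBr mulr1 [X in _ - X]mulrC.
by move=> i ni; rewrite fpsD fpsN fXnM ltnS (leq_trans ni nm) subr0.
Qed.

Lemma eulerP n m : (n <= m)%N -> agree n euler (euler_fin m).
Proof. by move=> nm i ni; rewrite (euler_fin_agree (leq_trans ni nm)). Qed.

Lemma euler_fin_coef0 n : euler_fin n 0%N = 1.
Proof. by rewrite (euler_fin_agree (leq0n n)) // euler_fin0. Qed.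

Lemma euler_coef0 : euler 0%N = 1.
Proof. exact: euler_fin_coef0. Qed.

(* Shanks' finite form of the pentagonal number theorem: all terms of
   [shanks n] but the first are divisible by q^(n+1). *)
Definition shanks n : fps R :=
  \sum_(0 <= s < n.+1)
    (-1) ^+ s * (\prod_(s.+1 <= i < n.+1) (1 - q ^+ i)) * q ^+ (s * n + 'C(s.+1, 2)).

Lemma shanks_agree n : agree n (shanks n) (euler_fin n).
Proof.
rewrite /shanks big_nat_recl // mul0n bin_small // mulr1 mul1r -/(euler_fin n).
rewrite -[X in agree _ _ X]addr0; apply: agreeD => //.
have z : 0 = \sum_(0 <= i < n) 0 :> fps R by rewrite big1_eq.
rewrite [X in agree _ _ X]z.
apply: agree_sum => s _; rewrite mulrC; apply: agree_fXn0.
by rewrite binS bin1 -addn1; nia.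
Qed.

Lemma shanksS n : shanks n.+1 = shanks n
  + (-1) ^+ n.+1 * (q ^+ (n.+1 ^ 2 + 'C(n.+1, 2)) + q ^+ (n.+1 ^ 2 + 'C(n.+2, 2))).
Proof.
pose D s : fps R := \prod_(s.+1 <= i < n.+1) (1 - q ^+ i).
pose c s : fps R := (-1) ^+ s * D s * q ^+ (s.+1 * n.+1 + 'C(s.+1, 2)).
have DS s : (s < n)%N -> D s = (1 - q ^+ s.+1) * D s.+1.
  by move=> sn; rewrite /D big_ltn.
have step s : (s <= n)%N -> \prod_(s.+1 <= i < n.+2) (1 - q ^+ i) = D s * (1 - q ^+ n.+1).
  by move=> sn; rewrite big_nat_recr.
(* On partial sums up to k everything telescopes except the boundary term [c k]. At k = n this term
   and the new summand of index n + 1 are the two pentagonal terms. *)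
suff H k : (k <= n)%N -> \sum_(0 <= s < k.+1)
    (-1) ^+ s * (\prod_(s.+1 <= i < n.+2) (1 - q ^+ i)) * q ^+ (s * n.+1 + 'C(s.+1, 2))
    = \sum_(0 <= s < k.+1) (-1) ^+ s * D s * q ^+ (s * n + 'C(s.+1, 2)) - c k.
  rewrite /shanks big_nat_recr //= H // -/(D _) big_geq // /c /D big_geq // -mulnn.
  by rewrite exprS; ring.
elim: k => [|k IH] kn.
  rewrite !big_nat1 step // /c !mul0n !bin_small // mul1n !addn0 !expr0; ring.
rewrite big_nat_recr //= IH ?(ltnW kn) // step // [in RHS]big_nat_recr //= /c.
rewrite (DS _ kn).
have -> : (k.+1 * n.+1 + 'C(k.+2, 2) = k.+1 * n + 'C(k.+1, 2) + k.+1 + k.+1)%N.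
  by rewrite (binS k.+1) bin1; lia.
have -> : (k.+2 * n.+1 + 'C(k.+2, 2) = k.+1 * n + 'C(k.+1, 2) + k.+1 + k.+1 + n.+1)%N.
  by rewrite (binS k.+1) bin1; lia.
have -> : (k.+1 * n + 'C(k.+2, 2) = k.+1 * n + 'C(k.+1, 2) + k.+1)%N.
  by rewrite (binS k.+1) bin1; lia.
have -> : (k.+1 * n.+1 + 'C(k.+1, 2) = k.+1 * n + 'C(k.+1, 2) + k.+1)%N by lia.
rewrite !(exprD q) [(-1) ^+ k.+1]exprS; ring.
Qed.

(** The quadratic character modulo 12: E is the sum of [chi12 x] q^((x^2 - 1)/24) over x >= 1. *)
Definition chi12 (x : nat) : int :=
  if (x %% 12)%N \in [:: 1; 11]%N then 1
  else if (x %% 12)%N \in [:: 5; 7]%N then -1 else 0.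

Lemma chi12_step n :
  [/\ chi12 (6 * n + 4) = 0, chi12 (6 * n + 5) = (-1) ^+ n.+1,
      chi12 (6 * n + 6) = 0, chi12 (6 * n + 7) = (-1) ^+ n.+1
    & chi12 (6 * n + 8) = 0 /\ chi12 (6 * n + 9) = 0].
Proof.
have sE : (-1) ^+ n.+1 = (if odd n then 1 else -1) :> int.
  by rewrite -signr_odd /=; case: odd.
have nE := odd_double_half n; rewrite -mul2n in nE.
rewrite sE /chi12; case: (odd n) nE => /= nE.
- have E j : ((6 * n + j) %% 12 = (6 + j) %% 12)%N by rewrite -nE; lia.
  by rewrite !E.
- have E j : ((6 * n + j) %% 12 = j %% 12)%N by rewrite -nE; lia.
  by rewrite !E.
Qed.

Lemma shanks_theta n :
  shanks n = \sum_(0 <= x < 6 * n + 4) (chi12 x)%:~R * q ^+ ((x ^ 2 - 1) %/ 24).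
Proof.
elim: n => [|n IH].
  rewrite /shanks big_nat1 big_geq // muln0 add0n !big_nat_recr //= big_geq //.
  by rewrite /chi12 /= bin_small // divn_small // !expr0; ring.
rewrite shanksS IH mulnS [(6 + _)%N]addnC -addnA -[(6 + 4)%N]/10%N.
have [e4 e5 e6 e7 [e8 e9]] := chi12_step n.
have -> : (6 * n + 10 = (6 * n + 4).+1.+1.+1.+1.+1.+1)%N by rewrite !addnS.
rewrite 6?big_nat_recr //= -!addnS e4 e5 e6 e7 e8 e9.
(* With m = n + 1 the surviving indices are 6m - 1 and 6m + 1, whose squares are 24 m(3m - 1)/2 + 1
   and 24 m(3m + 1)/2 + 1. *)
have d x k : (x ^ 2 = 24 * k + 1)%N -> ((x ^ 2 - 1) %/ 24 = k)%N.
  by move=> ->; rewrite addnK mulKn.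
rewrite (d (6 * n + 5)%N (n.+1 ^ 2 + 'C(n.+1, 2))%N); last first.
  by have := mul_bin_diag n.+1 1; rewrite bin1 /=; nia.
rewrite (d (6 * n + 7)%N (n.+1 ^ 2 + 'C(n.+2, 2))%N); last first.
  by have := mul_bin_diag n.+2 1; rewrite bin1 /=; nia.
rewrite rmorphXn /=; ring.
Qed.

Lemma euler_coef N :
  euler N = \sum_(0 <= x < 6 * N + 4) (chi12 x)%:~R * (N == (x ^ 2 - 1) %/ 24)%N%:R.
Proof.
rewrite /euler -shanks_agree // shanks_theta fps_sum.
by apply: eq_bigr => x _; rewrite fpsMintr fXn.
Qed.

(** A nonzero character value makes x prime to 6, so x^2 = 1 modulo 24 and the truncated quotient is
    exact. *)
Lemma chi12_eq0 N x : chi12 x != 0 -> (N == (x ^ 2 - 1) %/ 24)%N = (x ^ 2 == 24 * N + 1)%N.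
Proof.
move=> cx; have r : (x %% 12)%N \in [:: 1; 5; 7; 11]%N.
  by move: cx; rewrite /chi12; move: (x %% 12)%N; do 12![case=> //].
have [k xk] : exists k, (x ^ 2 = 24 * k + 1)%N.
  rewrite (divn_eq x 12); set d := (x %/ 12)%N; move: r; rewrite !inE.
  case/or4P => /eqP ->; [exists (6 * d ^ 2 + d)%N | exists (6 * d ^ 2 + 5 * d + 1)%N
    | exists (6 * d ^ 2 + 7 * d + 2)%N | exists (6 * d ^ 2 + 11 * d + 5)%N]; nia.
by rewrite xk addnK mulKn // eqn_add2r eqn_pmul2l // eq_sym.
Qed.

Lemma euler_square N x : (x ^ 2 = 24 * N + 1)%N -> euler N = (chi12 x)%:~R.
Proof.
move=> xN; have xlt : (x < 6 * N + 4)%N by nia.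
rewrite euler_coef big_mkord (bigD1 (Ordinal xlt)) //= big1 ?addr0 => [|y ny].
  have [->|cx] := eqVneq (chi12 x) 0; first by rewrite mul0r.
  by rewrite chi12_eq0 // xN eqxx mulr1.
have [->|cy] := eqVneq (chi12 y) 0; first by rewrite mul0r.
rewrite chi12_eq0 // -xN eqn_exp2r //; case: eqP => [e|_]; last by rewrite mulr0.
by case/eqP: ny; apply/val_inj.
Qed.

Lemma euler_nonsquare N : (forall x, x ^ 2 <> 24 * N + 1)%N -> euler N = 0.
Proof.
move=> nsq; rewrite euler_coef big1 // => x _.
have [->|cx] := eqVneq (chi12 x) 0; first by rewrite mul0r.
by rewrite chi12_eq0 //; case: eqP => [/nsq|]; rewrite ?mulr0.
Qed.

Lemma chi12M5 y : chi12 (5 * y) = - chi12 y.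
Proof.
rewrite /chi12 -modnMmr; have := @ltn_pmod y 12 isT; move: (y %% 12)%N.
by do 12![case=> //].
Qed.

(** If 24(5m + 1) + 1 = x^2 then x = 5y, m = 5j and y^2 = 24j + 1; the sign comes from [chi12M5]. *)
Lemma sect1_euler : sect 1 euler = - phi euler.
Proof.
apply/funext => m; rewrite /sect fpsN /phi; case: ifP => [/dvdnP[j ->]|ndv].
  rewrite mulnK //.
  have [[y yj]|nsq] := pselect (exists y, (y ^ 2 = 24 * j + 1)%N).
    rewrite (euler_square yj) (@euler_square _ (5 * y)); last by nia.
    by rewrite chi12M5 rmorphN.
  rewrite !euler_nonsquare ?oppr0 // => x e; apply: nsq; first by exists x.
  have : (5 %| x ^ 2)%N by rewrite e; lia.
  by rewrite Euclid_dvdX // => /andP[/dvdnP[y xy] _]; exists y; nia.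
rewrite oppr0 euler_nonsquare // => x e.
have : (5 %| x ^ 2)%N by rewrite e; lia.
by rewrite Euclid_dvdX // => /andP[/dvdnP[y xy] _]; move: ndv; nia.
Qed.

(** For N = 3 or 4 modulo 5, 24N + 1 is a quadratic nonresidue modulo 5. *)
Lemma sect_euler0 r : r \in [:: 3; 4]%N -> sect r euler = 0.
Proof.
move=> r34; apply/funext => m; rewrite /sect euler_nonsquare // => x e.
have : (x ^ 2 %% 5 = (24 * (5 * m + r) + 1) %% 5)%N by rewrite e.
rewrite -modnXm; have : (x %% 5 < 5)%N by rewrite ltn_mod.
move: r34; rewrite !inE => /orP[]/eqP->; case: (x %% 5)%N => [|[|[|[|[|]]]]] //= _; lia.
Qed.

Lemma euler_dissection :
  euler = phi (sect 0 euler) - q * phi (phi euler) + q ^+ 2 * phi (sect 2 euler).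
Proof.
by rewrite [LHS]sectE sect1_euler (@sect_euler0 3) // (@sect_euler0 4) //
  !raddf0 !mulr0 !addr0 raddfN mulrN.
Qed.

End EulerProduct.

(** * Jacobi's identity for E^3 *)

(** Carries the polynomial form of the generating function over to series, and embeds constants such
    as a root of unity. *)
Definition fps_of_poly (R : comNzRingType) (p : {poly R}) : fps R := fun n => p`_n.

Section FpsOfPoly.
Variable R : comNzRingType.

Lemma fps_of_poly_nmod : nmod_morphism (@fps_of_poly R).
Proof. by split=> [|p p']; apply/funext => n; rewrite /fps_of_poly ?coef0 ?coefD. Qed.
HB.instance Definition _ :=
  GRing.isNmodMorphism.Build {poly R} (fps R) (@fps_of_poly R) fps_of_poly_nmod.

Lemma fps_of_poly_monoid : monoid_morphism (@fps_of_poly R).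
Proof.
split=> [|p p']; apply/funext => n; rewrite /fps_of_poly ?coef1 ?fpsM ?coefM //.
Qed.
HB.instance Definition _ :=
  GRing.isMonoidMorphism.Build {poly R} (fps R) (@fps_of_poly R) fps_of_poly_monoid.

Lemma fps_of_polyX : fps_of_poly 'X = fX R.
Proof. by apply/funext => n; rewrite /fps_of_poly coefX. Qed.
End FpsOfPoly.

Definition cpart k : fps int := fun n => (p_minus k n)%:R.

Lemma euler_cpart k : euler int ^+ k * cpart k = 1.
Proof.
apply/funext => N; rewrite fps1 -(p_minus_gf k (leqnn N)).
rewrite (agreeM (agreeX k (eulerP int (leqnn N))) (@agree_refl _ N (cpart k))) //.
apply/esym/coefM_agree => i iN; last by rewrite coef_poly ltnS iN.
rewrite -[LHS]/(fps_of_poly (\prod_(1 <= j < N.+1) (1 - 'X^j) ^+ k) i).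
rewrite rmorph_prod /= /euler_fin -prodrXl; congr (_ i); apply: eq_bigr => j _.
by rewrite rmorphXn rmorphB rmorph1 rmorphXn /= fps_of_polyX.
Qed.

(** Both sides invert E^k. Hence every negative power of E is a power of [cpart 1]. *)
Lemma cpartX k : cpart k = cpart 1 ^+ k.
Proof.
have e1 := euler_cpart 1; rewrite expr1 in e1.
by rewrite -[LHS]mul1r -(expr1n _ k) -e1 exprMn mulrAC euler_cpart mul1r.
Qed.

(** * Gaussian binomials and Rothe's identity *)

Section GaussBinomial.
Variables (S : comNzRingType) (q : S).

(** Gaussian binomial coefficients, defined by a q-Pascal rule so that no division occurs. *)
Fixpoint gbin m j : S :=
  match m, j with
  | _, 0 => 1
  | 0, _.+1 => 0
  | m'.+1, j'.+1 => gbin m' j' + q ^+ j'.+1 * gbin m' j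
  end.

Lemma gbin0 m : gbin m 0 = 1. Proof. by case: m. Qed.

Lemma gbin_small m j : (m < j)%N -> gbin m j = 0.
Proof.
elim: m j => [|m IH] [|j] //= mj.
by rewrite !IH ?mulr0 ?addr0 // ltnW.
Qed.

(** Induction splits off the factor of index 0 and replaces x by qx in the others. The parameter c
    homogenizes the identity, so that c = q^n later avoids negative powers of q. *)
Lemma rothe x c m : \prod_(0 <= i < m) (c + q ^+ i * x)
  = \sum_(0 <= j < m.+1) q ^+ 'C(j, 2) * gbin m j * x ^+ j * c ^+ (m - j).
Proof.
elim: m x => [|m IH] x.
  by rewrite big_geq // big_nat1 bin_small // !expr0 gbin0 !mulr1.
rewrite big_ltn // big_add1 /= expr0 mul1r.
under eq_bigr => i _ do rewrite exprSr -mulrA.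
rewrite IH mulrDl !big_distrr /= big_ltn // [in RHS]big_ltn // !gbin0.
rewrite [in RHS]big_add1 /= big_add1 /=.
under [in RHS]eq_bigr => j _ do rewrite mulrDr !mulrDl.
rewrite big_split /= [RHS]addrCA [RHS]addrC; congr (_ + _ + _).
- rewrite !subn0 exprS; ring.
- rewrite [RHS]big_nat_recr //= gbin_small // !mulr0 !mul0r addr0.
  apply: eq_big_nat => j /andP[_ jm].
  by rewrite exprMn subSS -(subnSK jm) [c ^+ (_.+1)]exprS; ring.
- apply: eq_big_nat => j _.
  by rewrite exprMn (binS j) bin1 subSS exprD exprS; ring.
Qed.
End GaussBinomial.

Lemma gbin_polyC (S : comNzRingType) (q : S) m j : gbin q%:P m j = (gbin q m j)%:P.
Proof.
elim: m j => [|m IH] [|j] //=.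
by rewrite !IH polyCD polyCM polyC_exp.
Qed.

Section RotheDerivative.
Variables (S : comNzRingType) (q : S).

Lemma horner_deriv_term (a : S) j :
  ((a%:P * (- 'X) ^+ j)^`()).[1] = (-1) ^+ j * a *+ j.
Proof.
have -> : (- 'X) ^+ j = ((-1) ^+ j)%:P * 'X^j :> {poly S}.
  by rewrite polyC_exp polyCN polyC1 -exprNn.
rewrite mulrA -polyCM derivM derivC mul0r add0r derivXn hornerM hornerC hornerMn hornerXn.
by rewrite expr1n mulrnAr mulr1 [a * _]mulrC.
Qed.

(* Differentiate Rothe's identity for prod_(i < m) (q^n - z q^i) at the root z = 1. *)
Lemma rothe_deriv n m : (n < m)%N ->
  \sum_(0 <= j < m.+1) (-1) ^+ j * (q ^+ 'C(j, 2) * gbin q m j * q ^+ (n * (m - j))) *+ j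
  = - (q ^+ n * (\prod_(0 <= i < n) (q ^+ n - q ^+ i))
              * \prod_(n.+1 <= i < m) (q ^+ n - q ^+ i)).
Proof.
move=> nm; have := rothe q%:P (- 'X) (q ^+ n)%:P m.
move/(congr1 (fun p => p^`().[1])).
rewrite raddf_sum horner_sum /= => e.
transitivity (\prod_(0 <= i < m) ((q ^+ n)%:P + q%:P ^+ i * - 'X))^`().[1].
  rewrite e; apply: eq_bigr => j _.
  by rewrite gbin_polyC -!polyC_exp -polyCM [in RHS]mulrAC -polyCM -exprM horner_deriv_term.
(* The factor of index n vanishes at 1, so only the term that differentiates this factor
   survives. *)
rewrite (big_cat_nat (n := n)) ?(ltnW nm) //= [X in _ * X]big_ltn //.
set A := \prod_(_ <= _ < n) _; set B := \prod_(_ <= _ < _) _.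
have EA : A.[1] = \prod_(0 <= i < n) (q ^+ n - q ^+ i).
  rewrite horner_prod; apply: eq_bigr => i _.
  by rewrite -polyC_exp !hornerE; ring.
have EB : B.[1] = \prod_(n.+1 <= i < m) (q ^+ n - q ^+ i).
  rewrite horner_prod; apply: eq_bigr => i _.
  by rewrite -polyC_exp !hornerE; ring.
rewrite -EA -EB -polyC_exp !derivE !hornerE /=; ring.
Qed.
End RotheDerivative.

Section Jacobi.
Variable R : comNzRingType.
Local Notation q := (fX R).

(** The quotient formula for Gaussian binomials, with denominators cleared. *)
Lemma gbin_euler m j : (j <= m)%N ->
  gbin q m j * (euler_fin R j * euler_fin R (m - j)) = euler_fin R m.
Proof.
elim: m j => [|m IH] [|j] //=; rewrite ?gbin0 ?euler_fin0 ?subn0 ?mul1r //.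
rewrite ltnS subSS => jm; have IHj := IH _ jm.
rewrite [in RHS]euler_finS -IHj euler_finS.
have [mj|jlt] := leqP m j.
  have -> : m = j by apply/eqP; rewrite eqn_leq jm mj.
  rewrite [gbin _ j j.+1]gbin_small //; ring.
have := IH _ jlt; rewrite euler_finS -IHj -(subnSK jlt) euler_finS.
set G := gbin q m j; set G' := gbin q m j.+1 => e.
have -> : (m.+1 = j.+1 + (m - j.+1).+1)%N by lia.
rewrite exprD; move: e; set a := euler_fin R j; set b := euler_fin R _.
set u := q ^+ j.+1; set v := q ^+ _ => e.
transitivity (G * (a * (1 - u)) * (b * (1 - v)) + u * (1 - v) * (G' * (a * (1 - u) * b))).
  ring.
rewrite e; ring.
Qed.

Global Arguments gbin : simpl never.

Lemma gbin_sym m j : (j <= m)%N -> gbin q m j = gbin q m (m - j).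
Proof.
move=> jm; apply/eqP; rewrite -subr_eq0; apply/eqP.
apply: (@fps_reg _ (euler_fin R j * euler_fin R (m - j))).
  by rewrite fpsM big_ord1 subn0 !euler_fin_coef0 mulr1.
rewrite mulrC mulrBl gbin_euler //.
by rewrite [X in _ - _ * X]mulrC -{3}(subKn jm) gbin_euler ?leq_subr // subrr.
Qed.


(* The terms of index n - k and n + 1 + k of [rothe_deriv] are paired. *)
Lemma finite_jacobi n :
  \sum_(0 <= k < n.+1)
     (-1) ^+ k * q ^+ 'C(k.+1, 2) * gbin q (2 * n).+1 (n - k) *+ (2 * k).+1
  = euler_fin R n ^+ 2.
Proof.
have bin2D j : (2 * 'C(j, 2) + j = j * j)%N.
  by case: j => // j; rewrite -mul_bin_diag bin1 -mulnSr.
set m := (2 * n).+1; have nm : (n < m)%N by lia.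
have := rothe_deriv q nm.
rewrite (big_cat_nat (n := n.+1)) ?ltnS ?(ltnW nm) //=.
rewrite big_nat_rev /= -[X in \sum_(X <= _ < m.+1) _](add0n n.+1) big_addn.
have -> : (m.+1 - n.+1 = n.+1)%N by lia.
rewrite -big_split /=.
have -> : \prod_(0 <= i < n) (q ^+ n - q ^+ i) = (-1) ^+ n * q ^+ 'C(n, 2) * euler_fin R n.
  rewrite /euler_fin big_add1 /= [X in _ * X]big_nat_rev /= -bin2_sum -prodrXr.
  rewrite -[X in (-1) ^+ X](subn0 n) -prodr_const_nat -!big_split /=.
  apply: eq_big_nat => i /andP[_ ni].
  have {1}-> : (n = i + (0 + n - i.+1).+1)%N by lia.
  rewrite exprD; ring.
have -> : \prod_(n.+1 <= i < m) (q ^+ n - q ^+ i) = q ^+ (n * n) * euler_fin R n.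
  rewrite -[n.+1]add0n big_addn exprM.
  have -> : (m - n.+1 = n)%N by lia.
  have -> : (q ^+ n) ^+ n = \prod_(0 <= i < n) q ^+ n by rewrite prodr_const_nat subn0.
  rewrite /euler_fin big_add1 /= -big_split /=.
  apply: eq_big_nat => i _; rewrite addnS -addSn exprD; ring.
(* This power of q is common to the two products on the right of [e]; multiplying the goal by it and
   by (-1)^(n+1) turns its right side into that of [e]. *)
move=> e; apply: (@fXnI _ (n + 'C(n, 2) + n * n)%N) => /=.
rewrite -[LHS](signrMK n.+1) -[RHS](signrMK n.+1); congr (_ * _).
transitivity (- (q ^+ n * ((-1) ^+ n * q ^+ 'C(n, 2) * euler_fin R n) *
   (q ^+ (n * n) * euler_fin R n))); last by rewrite exprS !exprD; ring.
rewrite -e big_distrr big_distrr; apply: eq_big_nat => k /andP[_ kn].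
have -> : (0 + n.+1 - k.+1 = n - k)%N by lia.
have -> : gbin q m (k + n.+1) = gbin q m (n - k).
  by rewrite gbin_sym; last lia; congr (gbin _ _ _); lia.
set G := gbin q m _.
set E := (n + 'C(n, 2) + n * n + 'C(k.+1, 2))%N.
rewrite -(mulr_natr _ (2 * k).+1) -(mulr_natr _ (n - k)) -(mulr_natr _ (k + n.+1)).
transitivity ((-1) ^+ n.+1 * (-1) ^+ k * q ^+ E * G * (2 * k).+1%:R).
  by rewrite [q ^+ E]exprD /=; move: (_%:R) => c; ring.
have -> : (-1) ^+ (k + n.+1) = (-1) ^+ n.+1 * (-1) ^+ k :> fps R by rewrite exprD mulrC.
have -> : (-1) ^+ (n - k) = - ((-1) ^+ n.+1 * (-1) ^+ k) :> fps R.
  rewrite -{2}(@subnK k n) // exprS exprD -mulrA -mulrA -expr2 sqrr_sign; ring.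
have [d nE] : exists d, n = (d + k)%N by exists (n - k)%N; rewrite subnK.
have bE : E = ('C(k + n.+1, 2) + n * (m - (k + n.+1)))%N.
  rewrite /E /m nE.
  have -> : ((2 * (d + k)).+1 - (k + (d + k).+1) = d)%N by lia.
  have := bin2D (k + (d + k).+1)%N; have := bin2D (d + k)%N; have := bin2D k.+1; lia.
have bE' : E = ('C(n - k, 2) + n * (m - (n - k)))%N.
  rewrite /E /m nE addnK.
  have -> : ((2 * (d + k)).+1 - d = d + 2 * k + 1)%N by lia.
  have := bin2D d; have := bin2D (d + k)%N; have := bin2D k.+1; lia.
rewrite [q ^+ _ * G * _]mulrAC -(exprD q) -bE'.
rewrite [q ^+ 'C(k + n.+1, 2) * G * _]mulrAC -(exprD q) -bE.
(* The paired terms have opposite signs and equal powers of q, so their weights combine to (n + 1 +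
   k) - (n - k) = 2k + 1. *)
have -> : (k + n.+1 = n - k + (2 * k).+1)%N by lia.
rewrite natrD; move: ((n - k)%:R) (_%:R) => u v; ring.
Qed.
End Jacobi.

(** Multiply the finite identity by E. By [gbin_euler], the Gaussian binomial of index N - k times E
    is 1 modulo q^(N-k+1), and the accompanying power of q has exponent at least k. *)
Lemma agree_euler3 N : agree N (euler int ^+ 3)
  (\sum_(0 <= k < N.+1) (-1) ^+ k * fX int ^+ 'C(k.+1, 2) *+ (2 * k).+1).
Proof.
have Ey : euler int * cpart 1 = 1 by rewrite -[X in X * _]expr1 euler_cpart.
apply: (agree_trans (g := euler_fin int N ^+ 2 * euler int)).
  by rewrite exprSr; apply: agreeM => //; apply: agreeX; apply: eulerP.
rewrite -finite_jacobi big_distrl big_nat [X in agree _ _ X]big_nat.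
apply: agree_sum => k /andP[_ kN] /=; set g := gbin _ _ _.
have -> : (-1) ^+ k * fX int ^+ 'C(k.+1, 2) * g *+ (2 * k).+1 * euler int
    = (-1) ^+ k *+ (2 * k).+1 * (fX int ^+ 'C(k.+1, 2) * (g * euler int)).
  by rewrite !mulrnAl !mulrA.
rewrite -mulrnAl; apply: agreeM => //.
rewrite -[X in agree _ _ X]mulr1; apply: (agree_fXnM (k := (N - k)%N)); last first.
  by rewrite binS bin1; lia.
rewrite -[g * euler int]mulr1 -[X in _ * X]Ey mulrA -Ey; apply: agreeM => //.
rewrite -mulrA; apply: (agree_trans (g := euler_fin int (2 * N).+1)).
  rewrite -(@gbin_euler _ (2 * N).+1 (N - k)); last lia.
  by apply: agreeM => //; apply: agreeM; apply: eulerP; lia.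
by apply: agree_sym; apply: eulerP; lia.
Qed.

(** Triangular numbers are 0, 1 or 3 modulo 5. *)
Lemma sect2_euler3 : sect 2 (euler int ^+ 3) = 0.
Proof.
apply/funext => m; rewrite /sect (@agree_euler3 (5 * m + 2)%N) // fps_sum big1 // => k _.
suff e : (fX int ^+ 'C(k.+1, 2)) (5 * m + 2)%N = 0.
  by rewrite fpsMn -signr_odd; case: odd; rewrite ?mulN1r ?mul1r ?fpsN e ?oppr0 mul0rn.
rewrite fXn; case: eqP => // e; exfalso.
have := mul_bin_diag k.+1 1; rewrite bin1 -e /= (divn_eq k 5).
have : (k %% 5 < 5)%N by rewrite ltn_mod.
by case: (k %% 5)%N => [|[|[|[|[|]]]]] // _; nia.
Qed.

Lemma cube_dissection (R : comNzRingType) (a b c : fps R) :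
  (phi a - fX R * phi b + fX R ^+ 2 * phi c) ^+ 3
  = phi (a ^+ 3 - fX R * (3 * b * c ^+ 2))
    + fX R * phi (- 3 * a ^+ 2 * b + fX R * c ^+ 3)
    + fX R ^+ 2 * phi (3 * a * (a * c + b ^+ 2))
    + fX R ^+ 3 * phi (- b ^+ 3 - 6 * a * b * c)
    + fX R ^+ 4 * phi (3 * c * (a * c + b ^+ 2)).
Proof.
rewrite !(rmorphD, rmorphN, rmorphM, rmorphXn, rmorph_nat) /= phi_fX; ring.
Qed.

(** By [cube_dissection] the vanishing section of E^3 is 3a(ac + b^2). The factor 3 cancels over
    [int], and a cancels since its constant term is 1. *)
Lemma euler_sect02 : sect 0 (euler int) * sect 2 (euler int) = - phi (euler int) ^+ 2.
Proof.
apply/eqP; rewrite -addr_eq0; apply/eqP.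
set al := sect 0 _; set ga := sect 2 _; set be := phi (euler int).
apply: (@fps_reg _ al); first exact: euler_coef0.
have := sect2_euler3; rewrite euler_dissection -/al -/ga -/be.
rewrite cube_dissection sect_sum //= -mulrA mulr_natl => e; apply/funext => n.
have := congr1 (fun f : fps int => f n) e; rewrite fpsMn -[RHS]/(0 : int).
by move: (_ n) => x; rewrite fps0; lia.
Qed.

(** * The modular equation *)

Section FpsMap.
Variables (R S : comNzRingType) (f : {rmorphism R -> S}).

(** Change of coefficients: the norm of E is computed over [algC], which has fifth roots of unity,
    and the result descends to [int] by injectivity. *)
Definition fps_map (g : fps R) : fps S := fun n => f (g n).

Lemma fps_map_nmod : nmod_morphism fps_map.
Proof.
by split=> [|g h]; apply/funext => n; rewrite /fps_map ?fpsD ?rmorphD // rmorph0.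
Qed.
HB.instance Definition _ := GRing.isNmodMorphism.Build (fps R) (fps S) fps_map fps_map_nmod.

Lemma fps_map_monoid : monoid_morphism fps_map.
Proof.
split=> [|g h]; apply/funext => n; rewrite /fps_map; first by rewrite !fps1 rmorph_nat.
by rewrite !fpsM rmorph_sum; apply: eq_bigr => i _; rewrite rmorphM.
Qed.
HB.instance Definition _ :=
  GRing.isMonoidMorphism.Build (fps R) (fps S) fps_map fps_map_monoid.

Lemma fps_map_fX : fps_map (fX R) = fX S.
Proof. by apply/funext => n; rewrite /fps_map /fX rmorph_nat. Qed.

Lemma fps_map_phi g : fps_map (phi g) = phi (fps_map g).
Proof. by apply/funext => n; rewrite /fps_map /phi; case: ifP; rewrite ?rmorph0. Qed.

Lemma fps_map_sect r g : fps_map (sect r g) = sect r (fps_map g).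
Proof. by []. Qed.

Lemma fps_map_euler : fps_map (euler R) = euler S.
Proof.
apply/funext => n; rewrite /euler -[LHS]/(fps_map (euler_fin R n) n) rmorph_prod.
congr (_ n); apply: eq_bigr => i _.
by rewrite rmorphB rmorph1 rmorphXn /= fps_map_fX.
Qed.
End FpsMap.

Section Dilation.
Variables (R : comNzRingType) (z : R).

(** The substitution q -> zq; for z^5 = 1 it fixes series in q^5. *)
Definition dilate (f : fps R) : fps R := fun n => z ^+ n * f n.

Lemma dilate_nmod : nmod_morphism dilate.
Proof.
by split=> [|f g]; apply/funext => n; rewrite /dilate ?fpsD ?mulrDr ?mulr0.
Qed.
HB.instance Definition _ := GRing.isNmodMorphism.Build (fps R) (fps R) dilate dilate_nmod.

Lemma dilate_monoid : monoid_morphism dilate.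
Proof.
split=> [|f g]; apply/funext => n; rewrite /dilate.
  by case: n => [|n]; rewrite !fps1 ?mulr0 ?mulr1.
rewrite !fpsM big_distrr; apply: eq_bigr => i _ /=.
by rewrite -{1}(@subnKC i n) -1?ltnS // exprD mulrACA.
Qed.
HB.instance Definition _ := GRing.isMonoidMorphism.Build (fps R) (fps R) dilate dilate_monoid.

Lemma agree_dilate N f g : agree N f g -> agree N (dilate f) (dilate g).
Proof. by move=> fg n nN; rewrite /dilate fg. Qed.

Lemma dilate_phi f : z ^+ 5 = 1 -> dilate (phi f) = phi f.
Proof.
move=> z5; apply/funext => n; rewrite /dilate /phi.
case: ifP => [/dvdnP[k ->]|]; last by rewrite mulr0.
by rewrite mulnC exprM z5 expr1n mul1r.
Qed.

Lemma dilate_fX : dilate (fX R) = fps_of_poly z%:P * fX R.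
Proof.
apply/funext => n; rewrite mulrC fXM /dilate /fps_of_poly.
case: n => [|[|n]]; rewrite ?mulr0 ?mulr1 ?coefC ?expr1 //.
Qed.
End Dilation.

Lemma root5_prod (S : comNzRingType) (w x : S) : 1 + w + w ^+ 2 + w ^+ 3 + w ^+ 4 = 0 ->
  (1 - x) * (1 - w * x) * (1 - w ^+ 2 * x) * (1 - w ^+ 3 * x) * (1 - w ^+ 4 * x) = 1 - x ^+ 5.
Proof.
move=> w0; apply/eqP; rewrite -subr_eq0; apply/eqP.
(* The factor of 0 is the quotient of the difference of the two sides by 1 + w + w^2 + w^3 + w^4. *)
rewrite -[RHS](mulr0 ((1 - w + w ^+ 5 - w ^+ 6) * x ^+ 5 + w ^+ 6 * x ^+ 4
  - (w ^+ 3 + w ^+ 5) * x ^+ 3 + (w + w ^+ 3) * x ^+ 2 - x)) -w0.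
ring.
Qed.

Lemma root5_trinomial (S : comNzRingType) (w A B C : S) :
  1 + w + w ^+ 2 + w ^+ 3 + w ^+ 4 = 0 ->
  (A - B + C) * (A - w * B + w ^+ 2 * C) * (A - w ^+ 2 * B + w ^+ 4 * C)
    * (A - w ^+ 3 * B + w * C) * (A - w ^+ 4 * B + w ^+ 3 * C)
  = A ^+ 5 - B ^+ 5 + C ^+ 5 + 5 * A * B ^+ 3 * C - 5 * A ^+ 2 * B * C ^+ 2.
Proof.
(* The factor of 0 is the quotient of the difference of the two sides by
   1 + w + w^2 + w^3 + w^4, as polynomials in w. *)
move=> w0; apply/eqP; rewrite -subr_eq0; apply/eqP.
rewrite -[RHS](mulr0 (
 (w ^+ 4 + w ^+ 5 + 2 * w ^+ 6 + 2 * w ^+ 7 - w ^+ 8 + w ^+ 9) * (A * B ^+ 2 * C ^+ 2)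
 + (- w ^+ 7 - w ^+ 9) * (B ^+ 3 * C ^+ 2)
 + (w ^+ 7 + w ^+ 9) * (B ^+ 2 * C ^+ 3)
 + (- 5 + 5 * w - w ^+ 4 - 4 * w ^+ 5 + 2 * w ^+ 6 - w ^+ 7 - w ^+ 8) * (A * B ^+ 3 * C)
 + (- 2 * w ^+ 5 - w ^+ 6 - w ^+ 8) * (A * B * C ^+ 3)
 + w ^+ 8 * (B ^+ 4 * C)
 - w ^+ 8 * (B * C ^+ 4)
 + (w ^+ 2 + w ^+ 3 + 2 * w ^+ 4 + 2 * w ^+ 5 - w ^+ 6 + w ^+ 7) * (A ^+ 2 * B ^+ 2 * C)
 + (5 - 5 * w - w ^+ 2 - w ^+ 3 - w ^+ 4 - 2 * w ^+ 6) * (A ^+ 2 * B * C ^+ 2)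
 + w ^+ 6 * (A * B ^+ 4)
 + w ^+ 6 * (A * C ^+ 4)
 + (1 - w + w ^+ 5 - w ^+ 6) * B ^+ 5
 + (- 1 + w - w ^+ 5 + w ^+ 6) * C ^+ 5
 + (- w ^+ 3 - w ^+ 5) * (A ^+ 2 * B ^+ 3)
 + (w ^+ 3 + w ^+ 5) * (A ^+ 2 * C ^+ 3)
 + (- 2 * w - w ^+ 2 - w ^+ 4) * (A ^+ 3 * B * C)
 + (w + w ^+ 3) * (A ^+ 3 * B ^+ 2)
 + (w + w ^+ 3) * (A ^+ 3 * C ^+ 2)
 - A ^+ 4 * B
 + A ^+ 4 * C)) -w0.
ring.
Qed.

(** * The norm of E: the product of its conjugates under q -> zq *)

Section EulerNorm.
Variables (R : comNzRingType) (z : R).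
Hypothesis z0 : 1 + z + z ^+ 2 + z ^+ 3 + z ^+ 4 = 0.

Definition norm5 (f : fps R) : fps R :=
  f * dilate z f * dilate (z ^+ 2) f * dilate (z ^+ 3) f * dilate (z ^+ 4) f.

Lemma norm5M f g : norm5 (f * g) = norm5 f * norm5 g.
Proof. by rewrite /norm5 !rmorphM /=; ring. Qed.

Let w : fps R := fps_of_poly z%:P.

Let w0 : 1 + w + w ^+ 2 + w ^+ 3 + w ^+ 4 = 0.
Proof.
have <- : fps_of_poly (1 + z + z ^+ 2 + z ^+ 3 + z ^+ 4)%:P = 0 by rewrite z0 !raddf0.
by rewrite !polyCD !polyC_exp !rmorphD !rmorphXn /= polyC1 rmorph1.
Qed.

Let w5 : w ^+ 5 = 1.
Proof.
apply/eqP; rewrite -subr_eq0; apply/eqP.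
by rewrite -[RHS](mulr0 (w - 1)) -w0; ring.
Qed.

Let z5 : z ^+ 5 = 1.
Proof.
apply/eqP; rewrite -subr_eq0; apply/eqP.
by rewrite -[RHS](mulr0 (z - 1)) -z0; ring.
Qed.

Let dilateX k : dilate (z ^+ k) (fX R) = w ^+ k * fX R.
Proof. by rewrite dilate_fX /w polyC_exp rmorphXn. Qed.

(** If 5 divides i, all conjugates coincide; otherwise multiplication by i permutes the exponents 1,
    ..., 4 modulo 5 and [root5_prod] applies. *)
Lemma norm5_factor i :
  norm5 (1 - fX R ^+ i) = if (5 %| i)%N then (1 - fX R ^+ i) ^+ 5 else 1 - fX R ^+ (5 * i).
Proof.
have dl k : dilate (z ^+ k) (1 - fX R ^+ i) = 1 - w ^+ i ^+ k * fX R ^+ i.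
  by rewrite rmorphB rmorph1 rmorphXn /= dilateX exprMn -!exprM mulnC.
rewrite /norm5 -{1}[z]expr1 !dl expr1.
case: ifP => [/dvdnP[k ->]|ndv].
  by rewrite mulnC [w ^+ (5 * _)]exprM w5 !expr1n mul1r; ring.
rewrite root5_prod; first by rewrite -exprM mulnC.
have wm k : w ^+ k = w ^+ (k %% 5).
  by rewrite {1}(divn_eq k 5) exprD mulnC exprM w5 expr1n mul1r.
rewrite -!exprM (wm i) (wm (i * 2)%N) (wm (i * 3)%N) (wm (i * 4)%N).
rewrite -(modnMml i 2) -(modnMml i 3) -(modnMml i 4).
rewrite -[RHS]w0; move: ndv; rewrite /dvdn; have : (i %% 5 < 5)%N by rewrite ltn_mod.
move: (i %% 5)%N => r.
move=> r5 r0.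
have : [|| [&& (r * 2 %% 5 == 2)%N, (r * 3 %% 5 == 3)%N, (r * 4 %% 5 == 4)%N & (r == 1)%N],
  [&& (r * 2 %% 5 == 4)%N, (r * 3 %% 5 == 1)%N, (r * 4 %% 5 == 3)%N & (r == 2)%N],
  [&& (r * 2 %% 5 == 1)%N, (r * 3 %% 5 == 4)%N, (r * 4 %% 5 == 2)%N & (r == 3)%N] |
  [&& (r * 2 %% 5 == 3)%N, (r * 3 %% 5 == 2)%N, (r * 4 %% 5 == 1)%N & (r == 4)%N]].
  by case: r r5 r0 => [|[|[|[|[|]]]]].
by case/or4P => /and4P[/eqP-> /eqP-> /eqP-> /eqP->]; ring.
Qed.

(** Each induction step adds five factors: four of index prime to 5, and the one of index 5(m + 1),
    which enters to the fifth power. The factor [phi (phi _)] on the left supplies the indices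
    divisible by 5 that are missing from the product. *)
Lemma norm5_euler_fin m :
  norm5 (euler_fin R (5 * m)) * phi (phi (euler_fin R m))
  = phi (euler_fin R (5 * m)) * phi (euler_fin R m) ^+ 5.
Proof.
elim: m => [|m IH].
  by rewrite muln0 euler_fin0 /norm5 !rmorph1 expr1n !mulr1.
rewrite mulnS addnC !addnS addn0 !euler_finS !norm5M !norm5_factor.
have nd k : (5 %| (5 * m + k))%N = (5 %| k)%N by rewrite dvdn_addr // dvdn_mulr.
rewrite -[(5 * m).+1]addn1 -![(5 * m + 1).+1]addnS -![(5 * m + 2).+1]addnS.
rewrite -![(5 * m + 3).+1]addnS -![(5 * m + 4).+1]addnS !nd /=.
rewrite -[(5 * m + 5)%N]mulnSr !(rmorphB, rmorphM, rmorph1, rmorphXn) /= phi_fX.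
rewrite rmorphXn /= phi_fX -!exprM.
set N := norm5 _ in IH *.
transitivity (N * phi (phi (euler_fin R m)) * (1 - fX R ^+ (5 * (5 * m + 1)))
  * (1 - fX R ^+ (5 * (5 * m + 2))) * (1 - fX R ^+ (5 * (5 * m + 3)))
  * (1 - fX R ^+ (5 * (5 * m + 4))) * (1 - fX R ^+ (5 * m.+1)) ^+ 5
  * (1 - fX R ^+ (5 * 5 * m.+1))); first ring.
rewrite IH; set a := phi _; set b := phi _; rewrite -!mulnA; ring.
Qed.

Lemma agree_norm5 N f g : agree N f g -> agree N (norm5 f) (norm5 g).
Proof.
by move=> fg; do ![apply: agreeM]; rewrite //; apply: agree_dilate.
Qed.

Lemma norm5_euler : norm5 (euler R) * phi (phi (euler R)) = phi (euler R) ^+ 6.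
Proof.
apply/funext => m; have e5 : agree m (euler R) (euler_fin R (5 * m)).
  by apply: eulerP; rewrite leq_pmull.
have e1 : agree m (euler R) (euler_fin R m) by apply: eulerP.
have := congr1 (fun f : fps R => f m) (norm5_euler_fin m).
move=> e; rewrite exprS (agreeM (agree_norm5 e5) (agree_phi (agree_phi e1))) // e.
by rewrite (agreeM (agree_phi e5) (agreeX 5 (agree_phi e1))).
Qed.

(** Conjugation by z^k fixes A and multiplies B by w^k and C by w^(2k), so the norm is the product
    in [root5_trinomial]. *)
Lemma euler_norm_dissection :
  let A := phi (sect 0 (euler R)) in
  let B := fX R * phi (phi (euler R)) in
  let C := fX R ^+ 2 * phi (sect 2 (euler R)) in
  (A ^+ 5 - B ^+ 5 + C ^+ 5 + 5 * A * B ^+ 3 * C - 5 * A ^+ 2 * B * C ^+ 2)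
    * phi (phi (euler R)) = phi (euler R) ^+ 6.
Proof.
move=> A B C; rewrite -norm5_euler; congr (_ * _).
rewrite -(root5_trinomial A B C w0).
have dl k : dilate (z ^+ k) (euler R) = A - w ^+ k * B + w ^+ k ^+ 2 * C.
  have zk5 : z ^+ k ^+ 5 = 1 by rewrite exprAC z5 expr1n.
  rewrite {1}euler_dissection !(rmorphD, rmorphN, rmorphM, rmorphXn) /=.
  by rewrite !dilate_phi // dilateX /B /C; ring.
rewrite /norm5 -{1}[z]expr1 !dl {1}euler_dissection -/A -/B -/C.
have -> : w ^+ 3 ^+ 2 = w by rewrite -exprM (exprD w 5 1) w5 mul1r.
have -> : w ^+ 4 ^+ 2 = w ^+ 3 by rewrite -exprM (exprD w 5 3) w5 mul1r.
by rewrite expr1 -[w ^+ 2 ^+ 2]exprM.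
Qed.
End EulerNorm.

(* With xi = q E(q^25)/E(q) and t5 = q^5 E(q^25)^6/E(q^5)^6 this
   reads xi^5 = t5 (1 + 5 xi + 15 xi^2 + 25 xi^3 + 25 xi^4). *)
Lemma euler_modular_equation :
  let E := euler int in let B := fX int * phi (phi E) in
  phi E ^+ 6 = phi (phi E) *
    (E ^+ 5 + 5 * B * E ^+ 4 + 15 * B ^+ 2 * E ^+ 3 + 25 * B ^+ 3 * E ^+ 2 + 25 * B ^+ 4 * E).
Proof.
move=> E B.
have [z zp] := C_prim_root_exists (isT : (0 < 5)%N).
have z0 : 1 + z + z ^+ 2 + z ^+ 3 + z ^+ 4 = 0.
  have z5 := prim_expr_order zp.
  have /eqP : (z - 1) * (1 + z + z ^+ 2 + z ^+ 3 + z ^+ 4) = 0.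
    by transitivity (z ^+ 5 - 1); [ring | rewrite z5 subrr].
  rewrite mulf_eq0 subr_eq0 => /orP[/eqP z1|/eqP //].
  by have := prim_order_dvd zp 1; rewrite expr1 z1 eqxx.
have := euler_norm_dissection z0.
pose f : {rmorphism int -> algC} := intr.
rewrite -!(fps_map_euler f) -!fps_map_sect -!fps_map_phi -(fps_map_fX f).
set A := phi (sect 0 _); set C := phi (sect 2 _) => e.
have <- : (A ^+ 5 - B ^+ 5 + (fX int ^+ 2 * C) ^+ 5
    + 5 * A * B ^+ 3 * (fX int ^+ 2 * C) - 5 * A ^+ 2 * B * (fX int ^+ 2 * C) ^+ 2)
    * phi (phi E) = phi E ^+ 6.
  suff e' : fps_map f ((A ^+ 5 - B ^+ 5 + (fX int ^+ 2 * C) ^+ 5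
      + 5 * A * B ^+ 3 * (fX int ^+ 2 * C) - 5 * A ^+ 2 * B * (fX int ^+ 2 * C) ^+ 2)
      * phi (phi E)) = fps_map f (phi E ^+ 6).
    by apply/funext => n; apply: (@intr_inj algC); apply: (congr1 (@^~ n) e').
  rewrite /B -/E in e *; rewrite !(rmorphXn, rmorph_nat, rmorphN, rmorphD, rmorphM) /=.
  exact: e.
have ED : E = A - B + fX int ^+ 2 * C by exact: euler_dissection.
have AC : A * C = - phi (phi E) ^+ 2.
  by rewrite -rmorphM euler_sect02 rmorphN rmorphXn.
have ACB : A * (fX int ^+ 2 * C) = - B ^+ 2 by rewrite mulrCA AC /B; ring.
rewrite ED; move: ACB; move: (fX int ^+ 2 * C) => D; clear => ACB.
rewrite mulrC; congr (_ * _).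
have -> : 5 * A * B ^+ 3 * D = 5 * B ^+ 3 * (A * D) by ring.
have -> : 5 * A ^+ 2 * B * D ^+ 2 = 5 * B * (A * D) ^+ 2 by ring.
(* Since A D = - B^2, the two mixed terms contribute - 5 B^5 each. *)
transitivity (A ^+ 5 - 11 * B ^+ 5 + D ^+ 5); first by rewrite ACB; ring.
apply/eqP; rewrite -subr_eq0; apply/eqP.
(* After E is replaced by A - B + D, the two sides differ by this multiple of A D + B^2. *)
rewrite -[RHS](mulr0 (- 5 * (A ^+ 3 + 2 * A ^+ 2 * D + A * B ^+ 2 + 2 * A * D ^+ 2
  + B ^+ 2 * D + D ^+ 3))) -(subrr (- B ^+ 2)) -{1}ACB.
ring.
Qed.

(** * The action of U on powers of T *)

Lemma sectX (R : comNzRingType) r (f : fps R) : (0 < r <= 5)%N ->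
  sect 0 (fX R ^+ r * f) = fX R * sect (5 - r) f.
Proof.
move=> /andP[r0 r5]; apply/funext => n; rewrite /sect fXnM fXM addn0.
case: n => [|n]; first by rewrite muln0 r0.
by rewrite ltnNge (_ : (r <= 5 * n.+1)%N) /=; [congr f; lia | lia].
Qed.

Lemma sectMz (R : comNzRingType) r (c : int) (f : fps R) :
  sect r (c%:~R * f) = c%:~R * sect r f.
Proof. by rewrite !mulrzl raddfMz. Qed.

Lemma sect_natM (R : comNzRingType) r m (f : fps R) :
  sect r (m%:R * f) = m%:R * sect r f.
Proof. by rewrite !mulr_natl raddfMn. Qed.

Local Notation X := (fX int).
Local Notation E := (euler int).
Local Notation E5 := (phi E).
Local Notation y := (cpart 1).

Lemma euler_y : E * y = 1.
Proof. by rewrite -[X in X * _]expr1 euler_cpart. Qed.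

Lemma eulerXy k : E ^+ k * y ^+ k = 1.
Proof. by rewrite -exprMn euler_y expr1n. Qed.

Lemma phi_eulerXy k : E5 ^+ k * phi y ^+ k = 1.
Proof. by rewrite -exprMn -rmorphM euler_y rmorph1 expr1n. Qed.

(** Expand powers of the three-term dissection of E and substitute ac = - b^2. The first four values
    start the recurrence for U (xi^k) at negative k; the last one serves the final congruences. *)
Lemma sect_euler :
  [/\ sect 4 (E ^+ 4) = - 5 * E5 ^+ 4, sect 3 (E ^+ 3) = 5 * E5 ^+ 3,
      sect 2 (E ^+ 2) = - E5 ^+ 2, sect 1 E = - E5
    & sect 4 (E ^+ 3) = 0].
Proof.
have := euler_sect02; have := euler_dissection int.
set a := sect 0 E; set c := sect 2 E; set b := E5 => ED ac.
have E2 : E ^+ 2 = phi (a ^+ 2) + X * phi (- 2 * a * b) + X ^+ 2 * phi (b ^+ 2 + 2 * a * c)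
    + X ^+ 3 * phi (- 2 * b * c) + X ^+ 4 * phi (c ^+ 2).
  rewrite {1}ED !(rmorphD, rmorphN, rmorphM, rmorphXn, rmorph_nat) /=; ring.
have E4 : E ^+ 4 = phi (a ^+ 4 + X * (- 4 * a * b * c ^+ 2 - 4 * (b ^+ 2 + 2 * a * c) * b * c))
    + X * phi (- 4 * a ^+ 3 * b + X * (2 * (b ^+ 2 + 2 * a * c) * c ^+ 2 + 4 * b ^+ 2 * c ^+ 2))
    + X ^+ 2 * phi (2 * a ^+ 2 * (b ^+ 2 + 2 * a * c) + 4 * a ^+ 2 * b ^+ 2
                    + X * (- 4 * b * c ^+ 3))
    + X ^+ 3 * phi (- 4 * a ^+ 2 * b * c - 4 * a * b * (b ^+ 2 + 2 * a * c) + X * c ^+ 4)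
    + X ^+ 4 * phi (2 * a ^+ 2 * c ^+ 2 + 8 * a * b ^+ 2 * c + (b ^+ 2 + 2 * a * c) ^+ 2).
  rewrite (exprM E 2 2) E2 !(rmorphD, rmorphN, rmorphM, rmorphXn, rmorph_nat) /= phi_fX.
  ring.
split.
- rewrite E4 sect_sum //=.
  transitivity (2 * (a * c) ^+ 2 + 8 * b ^+ 2 * (a * c) + (b ^+ 2 + 2 * (a * c)) ^+ 2).
    by ring.
  rewrite ac; ring.
- rewrite ED cube_dissection sect_sum //= -!mulrA [b * c]mulrC [a * _]mulrA ac; ring.
- rewrite E2 sect_sum //= -mulrA ac; ring.
- exact: sect1_euler.
- by rewrite ED cube_dissection sect_sum //= ac addNr mulr0.
Qed.

(* With xi = q E(q^25)/E(q), the section U (xi^(k - 4)) is [upoly k] evaluated at T;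
   the shift by 4 makes the five initial values the constants U (xi^(-4)), ...,
   U (xi^0), and the recurrence is the modular equation. *)
Fixpoint upoly (k : nat) : {poly int} :=
  match k with
  | 0 => - 5
  | 1 => 5
  | 2 => - 1
  | 3 => - 1
  | 4 => 1
  | (((((k0.+1) as k1).+1 as k2).+1 as k3).+1 as k4).+1 =>
      'X * (25 * upoly k4 + 25 * upoly k3 + 15 * upoly k2
            + 5 * upoly k1 + upoly k0)
  end.

Lemma upolyS k : upoly k.+4.+1 = 'X * (25 * upoly k.+4 + 25 * upoly k.+3
  + 15 * upoly k.+2 + 5 * upoly k.+1 + upoly k).
Proof. by []. Qed.

(** The series T, a Hauptmodul for Gamma_0(5), with E^(-6) written as [y ^+ 6]. *)
Definition hauptmodul : fps int := X * E5 ^+ 6 * y ^+ 6.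
Local Notation T := hauptmodul.

Definition evT : {rmorphism {poly int} -> fps int} :=
  horner_morph (fun c : int => mulrC T (c%:~R)).

Lemma evTC c : evT c%:P = c%:~R.
Proof. exact: horner_morphC. Qed.

Lemma evTX : evT 'X = T.
Proof. exact: horner_morphX. Qed.

(** The series under [sect] is q^5 E(q^25)^(4-k) xi^(k-4), and U sends it to q E(q^5)^(4-k) U
    (xi^(k-4)); the outer factor [E5 ^+ k] clears the denominator. *)
Lemma sect_upoly k :
  E5 ^+ k * sect 0 (X ^+ k.+1 * (E ^+ 4 * y ^+ k)) = X * E5 ^+ 4 * evT (upoly k).
Proof.
have [s4 s3 s2 s1 _] := sect_euler.
elim/ltn_ind: k => k IH; move: k IH.
have Ey := euler_y.
case=> [_|[_|[_|[_|[_|k IH]]]]].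
- by rewrite expr0 mulr1 mul1r sectX //= s4 rmorphN rmorph_nat; ring.
- rewrite (_ : E ^+ 4 * y ^+ 1 = E ^+ 3); last by rewrite expr1 exprSr -mulrA Ey mulr1.
  by rewrite sectX //= s3 rmorph_nat; ring.
- rewrite (_ : E ^+ 4 * y ^+ 2 = E ^+ 2); last first.
    by rewrite (exprD E 2 2) -mulrA eulerXy mulr1.
  by rewrite sectX //= s2 rmorphN rmorph1; ring.
- rewrite (_ : E ^+ 4 * y ^+ 3 = E); last first.
    by rewrite (exprS E) -mulrA eulerXy mulr1.
  by rewrite sectX //= s1 rmorphN rmorph1; ring.
- rewrite eulerXy sectX //= rmorph1.
  have -> : sect 0 (1 : fps int) = 1 by apply/funext => -[|n].
  ring.
have step (i : nat) :
    sect 0 (X ^+ 5 * (phi (phi E) ^+ i.+1 * (X ^+ (k + i).+1 * (E ^+ 4 * y ^+ (k + i)))))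
    = X * E5 ^+ i.+1 * sect 0 (X ^+ (k + i).+1 * (E ^+ 4 * y ^+ (k + i))).
  by rewrite -phi_fX -rmorphXn !sectM // mulrA.
set G := fun k => sect 0 (X ^+ k.+1 * (E ^+ 4 * y ^+ k)) in IH step *.
(* U applied to the modular equation times q^(k+6) E^4 y^(k+5); each E(q^25) comes out of U as
   E(q^5). *)
have key : E ^+ 6 * G k.+4.+1 = X * E5 ^+ 1 * G (k + 0)%N + 5 * (X * E5 ^+ 2 * G (k + 1)%N)
    + 15 * (X * E5 ^+ 3 * G (k + 2)%N) + 25 * (X * E5 ^+ 4 * G (k + 3)%N)
    + 25 * (X * E5 ^+ 5 * G (k + 4)%N).
  rewrite /G -!step -sectM // rmorphXn /= euler_modular_equation.
  rewrite -!sect_natM -!raddfD /=; congr (sect _ _).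
  have yi i j : (i + j = 5)%N -> y ^+ (k + i) = E ^+ j * y ^+ k.+4.+1.
    move=> ij; rewrite (_ : k.+4.+1 = k + i + j)%N; last lia.
    by rewrite [y ^+ (k + i + j)]exprD mulrCA eulerXy mulr1.
  rewrite (yi 0 5)%N // (yi 1 4)%N // (yi 2 3)%N // (yi 3 2)%N // (yi 4 1)%N //.
  move: (y ^+ _) (phi (phi E)) => u B; rewrite !(exprS X) !(exprD X); ring.
rewrite upolyS !(rmorph_nat, rmorphM, rmorphD) evTX.
have IHi i : (i < 5)%N -> E5 ^+ (k + i) * G (k + i)%N = X * E5 ^+ 4 * evT (upoly (k + i)).
  by move=> i5; apply: IH; lia.
have IH0 := IHi 0%N isT; rewrite addn0 in key IH0.
have keyE : G k.+4.+1 = y ^+ 6 * (E ^+ 6 * G k.+4.+1).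
  by rewrite mulrA [y ^+ 6 * _]mulrC eulerXy mul1r.
rewrite -/(G _) keyE key -[k.+4]addn4 -[k.+3]addn3 -[k.+2]addn2 -[k.+1]addn1.
transitivity (y ^+ 6 * X * E5 ^+ 6 * (E5 ^+ k * G k + 5 * (E5 ^+ (k + 1) * G (k + 1)%N)
  + 15 * (E5 ^+ (k + 2) * G (k + 2)%N) + 25 * (E5 ^+ (k + 3) * G (k + 3)%N)
  + 25 * (E5 ^+ (k + 4) * G (k + 4)%N))); last first.
  by rewrite IH0 !IHi // /T; ring.
rewrite !(exprS E5) !(exprD E5); ring.
Qed.


Lemma coef_upolyS k j : (upoly k.+4.+1)`_j.+1 = 25 * (upoly k.+4)`_j
  + 25 * (upoly k.+3)`_j + 15 * (upoly k.+2)`_j + 5 * (upoly k.+1)`_j + (upoly k)`_j.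
Proof. by rewrite upolyS coefXM /= !coefD !mulr_natl !coefMn. Qed.

Lemma coef_upolyS0 k : (upoly k.+4.+1)`_0 = 0.
Proof. by rewrite upolyS coefXM. Qed.

Lemma coef_upoly_small k j : (j < 5)%N -> (upoly j)`_k.+1 = 0.
Proof.
by case: j => [|[|[|[|[|]]]]] //= _; rewrite -1?polyCN ?coefN ?coef1 -?polyC_natr ?coefC ?oppr0.
Qed.

(** The recurrence gains a factor 'X at every five indices. *)
Lemma upoly_coef0 k j : (5 * j + 4 < k)%N -> (upoly k)`_j = 0.
Proof.
elim/ltn_ind: k j => k IH [|j] kj.
  by case: k kj {IH} => [|[|[|[|[|k]]]]] // _; rewrite coef_upolyS0.
case: k kj IH => [|[|[|[|[|k]]]]] kj IH; try lia.
by rewrite coef_upolyS !IH; (lia || rewrite !mulr0 !addr0).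
Qed.

Lemma dvdz_weaken a b c (x : int) : (c <= a + b)%N ->
  ((5 ^+ b : int) %| x)%Z -> ((5 ^+ c : int) %| 5 ^+ a * x)%Z.
Proof.
move=> cab bx; apply: (@dvdz_trans (5 ^+ (a + b))).
  by rewrite dvdz_exp2l.
by rewrite exprD dvdz_mul.
Qed.

(** In the recurrence, the term of index k + i loses at most ceil(i/2) in the exponent of 5; the
    coefficients 1, 5, 15, 25, 25 for i = 0, ..., 4 make up for it. *)
Lemma upoly_dvd k j : ((5 ^+ ((5 * j + 3 - k) %/ 2) : int) %| (upoly k)`_j)%Z.
Proof.
elim/ltn_ind: k j => k IH [|j].
  case: k {IH} => [|[|[|[|[|k]]]]]; rewrite ?coef_upolyS0 ?dvdz0 // /=
    ?muln0 ?add0n ?expr0 ?dvd1z //.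
  - by rewrite coefN -polyC_natr coefC.
  - by rewrite -polyC_natr coefC.
have [k5|k5] := ltnP k 5; first by rewrite coef_upoly_small ?dvdz0.
case: k IH k5 => [|[|[|[|[|k]]]]] // IH _.
rewrite coef_upolyS.
have t i a : (i < 5)%N -> (i <= 2 * a)%N ->
    ((5 ^+ ((5 * j.+1 + 3 - k.+4.+1) %/ 2) : int) %| 5 ^+ a * (upoly (k + i))`_j)%Z.
  move=> i5 ia; apply: (@dvdz_weaken a ((5 * j + 3 - (k + i)) %/ 2)); last by apply: IH; lia.
  by move: ia; clear; lia.
have := t 0%N 0%N isT isT; have := t 1%N 1%N isT isT; have := t 2%N 1%N isT isT.
have := t 3%N 2%N isT isT; have := t 4%N 2%N isT isT.
rewrite addn0 addn1 addn2 [(k + 3)%N]addn3 addn4 expr0 mul1r => h4 h3 h2 h1 h0.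
set u4 := (upoly k.+4)`_j in h4 *; set u3 := (upoly k.+3)`_j in h3 *.
set u2 := (upoly k.+2)`_j in h2 *; set u1 := (upoly k.+1)`_j in h1 *.
have -> : 25 * u4 + 25 * u3 + 15 * u2 + 5 * u1 + (upoly k)`_j
  = 5 ^+ 2 * u4 + 5 ^+ 2 * u3 + 3 * (5 ^+ 1 * u2) + 5 ^+ 1 * u1 + (upoly k)`_j by ring.
apply: (rpredD _ h0); apply: (rpredD _ h1).
by apply: (rpredD _ (dvdz_mull _ h2)); apply: (rpredD h4 h3).
Qed.

(* T^i = xi^(6i) / T(q^5)^i, hence U (T^i) = T^(-i) U (xi^(6i)). *)
Definition Umon i : {poly int} := drop_poly i (upoly (6 * i + 4)).

Lemma coef_Umon i j : (Umon i)`_j = (upoly (6 * i + 4))`_(j + i).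
Proof. exact: coef_drop_poly. Qed.

(** [upoly_dvd] at index 6i + 4 and degree i + j. *)
Lemma Umon_dvd i j : ((5 ^+ ((5 * j - i - 1) %/ 2) : int) %| (Umon i)`_j)%Z.
Proof.
rewrite coef_Umon; apply: dvdz_trans (upoly_dvd _ _).
by apply: dvdz_exp2l; apply: leq_div2r; lia.
Qed.

Lemma Umon_coef0 i : (0 < i)%N -> (Umon i)`_0 = 0.
Proof. by move=> i0; rewrite coef_Umon upoly_coef0; lia. Qed.

Lemma upoly_Umon i : upoly (6 * i + 4) = 'X^i * Umon i.
Proof.
apply/polyP => j; rewrite coefXnM coef_Umon; case: ltnP => ij; last by rewrite subnK.
by rewrite upoly_coef0; lia.
Qed.

Lemma sect_hauptmodulX i : sect 0 (T ^+ i) = evT (Umon i).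
Proof.
have TX : T ^+ i = X ^+ i * (E5 ^+ (6 * i) * y ^+ (6 * i)).
  by rewrite /hauptmodul 2!exprMn -!exprM mulrA.
have e := sect_upoly (6 * i + 4).
have e1 : X ^+ (6 * i + 4).+1 * (E ^+ 4 * y ^+ (6 * i + 4))
    = phi (X ^+ i.+1) * (X ^+ i * y ^+ (6 * i)).
  rewrite rmorphXn /= phi_fX -exprM [y ^+ (_ + 4)]exprD [E ^+ 4 * _]mulrCA eulerXy mulr1.
  by rewrite mulrA -exprD; congr (X ^+ _ * _); lia.
rewrite e1 sectM // upoly_Umon rmorphM rmorphXn /= evTX in e.
rewrite TX.
have -> : X ^+ i * (E5 ^+ (6 * i) * y ^+ (6 * i)) = phi (E ^+ (6 * i)) * (X ^+ i * y ^+ (6 * i)).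
  by rewrite rmorphXn mulrCA.
rewrite sectM //; apply: (@fXnI _ i.+1) => /=; rewrite mulrCA.
have -> : X ^+ i.+1 * sect 0 (X ^+ i * y ^+ (6 * i)) = X ^+ i.+1 * (y ^+ (6 * i) * evT (Umon i)).
  rewrite -[LHS]mul1r -(phi_eulerXy (6 * i + 4)) mulrAC e TX.
  transitivity (E5 ^+ (6 * i + 4) * phi y ^+ (6 * i + 4)
    * (X ^+ i.+1 * (y ^+ (6 * i) * evT (Umon i)))).
    rewrite [E5 ^+ (_ + _)]exprD (exprS X); ring.
  by rewrite phi_eulerXy mul1r.
by rewrite mulrCA [E ^+ _ * _]mulrA eulerXy mul1r.
Qed.

(* [lpoly a] is the polynomial L_(a+1). *)
Fixpoint lpoly a : {poly int} :=
  if a is a'.+1 then \sum_(j < size (lpoly a')) (lpoly a')`_j *: Umon j.+1 else Umon 1.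

Lemma lpolyS a : lpoly a.+1 = \sum_(j < size (lpoly a)) (lpoly a)`_j *: Umon j.+1.
Proof. by []. Qed.

Lemma evTZ c p : evT (c *: p) = c%:~R * evT p.
Proof. by rewrite -mul_polyC rmorphM /= evTC. Qed.

Lemma sect_lpoly a : sect 0 (T * evT (lpoly a)) = evT (lpoly a.+1).
Proof.
rewrite lpolyS -{1}[lpoly a]coefK poly_def !rmorph_sum /= big_distrr raddf_sum /=.
apply: eq_bigr => j _.
by rewrite !evTZ rmorphXn /= evTX mulrCA -exprS sectMz sect_hauptmodulX.
Qed.

Lemma lpoly_coef0 a : (lpoly a)`_0 = 0.
Proof.
case: a => [|a]; first exact: Umon_coef0.
by rewrite lpolyS coef_sum big1 // => j _; rewrite coefZ Umon_coef0 ?mulr0.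
Qed.

(** The bounds for the coefficient of T^i and for U (T^(i+1)) are added. At i = 1 they give exactly
    the required exponent, and for larger i more. *)
Lemma lpoly_dvd a j :
  ((5 ^+ (a.+1 + (5 * j - 5) %/ 2) : int) %| (lpoly a)`_j)%Z.
Proof.
case: j => [|j]; first by rewrite lpoly_coef0 dvdz0.
elim: a j => [|a IH] j.
  by apply: dvdz_trans (Umon_dvd _ _); apply: dvdz_exp2l; lia.
rewrite lpolyS coef_sum; apply: rpred_sum => -[[|i] ilt] _ /=; rewrite coefZ.
  by rewrite lpoly_coef0 mul0r dvdz0.
apply: dvdz_trans (dvdz_mul (IH i) (Umon_dvd _ _)).
by rewrite -exprD; apply: dvdz_exp2l; lia.
Qed.

(** The series of the c_a(n). The division by 4 is exact because 5^a = 1 modulo 4. *)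
Definition pshift a : fps int := fun n => (p_minus 6 (5 ^ a * n + (3 * 5 ^ a + 1) %/ 4))%:R.

Lemma mod4_5X a : (5 ^ a %% 4 = 1)%N.
Proof. by rewrite -modnXm exp1n. Qed.

Lemma pshift_lpoly a : X * pshift a.+1 = y ^+ 6 * evT (lpoly a).
Proof.
(* Since T = q E(q^5)^6 E^(-6), multiplying q E^(-6) f by E(q^5)^6 gives T f, and U turns this
   factor into E^6. *)
have sy f : sect 0 (X * (y ^+ 6 * f)) = y ^+ 6 * sect 0 (T * f).
  rewrite (_ : T * f = phi (E ^+ 6) * (X * (y ^+ 6 * f))); last first.
    by rewrite rmorphXn /hauptmodul; ring.
  by rewrite sectM // [RHS]mulrA [y ^+ 6 * E ^+ 6]mulrC eulerXy mul1r.
elim: a => [|a IH].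
  rewrite /= -sect_hauptmodulX -[T ^+ 1]mulr1 expr1 -sy mulr1 -cpartX -[X in X * cpart 6]expr1.
  by rewrite sectX.
rewrite -sect_lpoly -sy -IH mulrA -expr2 sectX //; congr (_ * _).
(* The section is of index 3, and 3c + (3c + 1)/4 = (15c + 1)/4 for c = 5^(a+1). *)
apply/funext => n; rewrite /sect /pshift; congr (p_minus 6 _)%:R.
by have := mod4_5X a.+1; rewrite [(5 ^ a.+2)%N]expnS; move: (5 ^ a.+1)%N => c; lia.
Qed.

(** * The congruences *)

Lemma poly_dvdz (d : int) (p : {poly int}) :
  (forall j, (d %| p`_j)%Z) -> exists p', p = d *: p'.
Proof.
move=> dp; exists (\poly_(j < size p) (p`_j %/ d)%Z); apply/polyP => j.
rewrite coefZ coef_poly; case: ltnP => [_|/(nth_default 0)->]; last by rewrite mulr0.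
by rewrite mulrC divzK.
Qed.

(** By [lpoly_dvd] the terms from T^2 on carry at least one more factor 5 than the term in T, and
    E^(-6) T = q E(q^5)^6 E^(-12). *)
Lemma pshift_expansion a : exists (c : int) (h : fps int),
  pshift a.+1 = (5 ^+ a.+1)%:~R * (c%:~R * (E5 ^+ 6 * y ^+ 12) + 5 * h).
Proof.
pose l := lpoly a; pose l' := drop_poly 1 l.
have /dvdzP[c lc] : ((5 ^+ a.+1 : int) %| l`_1)%Z.
  by apply: dvdz_trans (lpoly_dvd _ _); apply: dvdz_exp2l; lia.
have [|p lp] := @poly_dvdz (5 ^+ a.+2) (l' - (l`_1)%:P).
  move=> j; rewrite coefB coefC coef_drop_poly addn1; case: j => [|j].
    by rewrite subrr dvdz0.
  by rewrite subr0; apply: dvdz_trans (lpoly_dvd _ _); apply: dvdz_exp2l; lia.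
exists c, (E5 ^+ 6 * y ^+ 12 * evT p).
have lX : l = 'X * ((c * 5 ^+ a.+1)%:P + 5 ^+ a.+2 *: p).
  rewrite -lp lc [_ + (_ - _)]addrC subrK; apply/polyP => -[|j]; rewrite coefXM /=.
    exact: lpoly_coef0.
  by rewrite coef_drop_poly addn1.
apply: (@fXnI _ 1) => /=; rewrite expr1 pshift_lpoly -/l lX rmorphM rmorphD /= evTX evTC evTZ.
rewrite rmorphM /hauptmodul (exprD y 6 6) (exprS 5 a.+1) rmorphM /=.
move: ((5 ^+ a.+1)%:~R) (c%:~R) => u v; ring.
Qed.

(** Modulo 5 the modular equation reduces to E(q^5)^6 = E(q^25) E^5, so E^(-5) is a series in
    q^5. *)
Lemma euler_inv_pow5 : exists g h, y ^+ 5 = phi g + 5 * h.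
Proof.
pose B := X * phi E5; pose g := E5 * y ^+ 6.
pose S := B * E ^+ 4 + 3 * B ^+ 2 * E ^+ 3 + 5 * B ^+ 3 * E ^+ 2 + 5 * B ^+ 4 * E.
exists g, (phi g * S * y ^+ 5).
have e : E5 ^+ 6 = phi E5 * (E ^+ 5 + 5 * S) by rewrite euler_modular_equation /S /B; ring.
transitivity (y ^+ 5 * (E5 ^+ 6 * phi y ^+ 6)); first by rewrite phi_eulerXy mulr1.
transitivity (phi g * (E ^+ 5 * y ^+ 5 + 5 * S * y ^+ 5)).
  by rewrite e /g rmorphM rmorphXn /=; ring.
by rewrite eulerXy; ring.
Qed.

(** E^(-12) = E^3 (E^(-5))^3 is, modulo 5, E^3 times a series in q^5, and E^3 has no exponents
    congruent to 2 or 4. *)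
Lemma sect_leading_term r : (r == 2) || (r == 4) ->
  exists h, sect r (E5 ^+ 6 * y ^+ 12) = 5 * h.
Proof.
move=> r24; have [g [h y5]] := euler_inv_pow5.
have s3 : sect r (E ^+ 3) = 0.
  have [_ _ _ _ s4] := sect_euler.
  by case/orP: r24 => /eqP ->; [exact: sect2_euler3 | exact: s4].
(* The witness comes from factoring u^3 - v^3 with u = y^5, v = [phi g] and u - v = 5h. *)
exists (sect r (E5 ^+ 6 * E ^+ 3 * h * (y ^+ 10 + y ^+ 5 * phi g + phi g ^+ 2))).
rewrite -sect_natM.
have -> : E5 ^+ 6 * y ^+ 12
    = phi (E ^+ 6 * g ^+ 3) * E ^+ 3
      + 5 * (E5 ^+ 6 * E ^+ 3 * h * (y ^+ 10 + y ^+ 5 * phi g + phi g ^+ 2)).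
  transitivity (E5 ^+ 6 * (E ^+ 3 * y ^+ 3) * y ^+ 12); first by rewrite eulerXy mulr1.
  transitivity (E5 ^+ 6 * E ^+ 3 * (y ^+ 5) ^+ 3); first by ring.
  have -> : y ^+ 5 ^+ 3 = phi g ^+ 3 + (y ^+ 5 - phi g) * (y ^+ 10 + y ^+ 5 * phi g + phi g ^+ 2).
    by ring.
  rewrite {1}y5 rmorphM !rmorphXn /=; ring.
by rewrite raddfD /= sectM ?s3 ?mulr0 ?add0r //; case/orP: r24 => /eqP ->.
Qed.

Lemma pshift_dvd a n : (5 ^ a.+1 %| p_minus 6 (5 ^ a.+1 * n + (3 * 5 ^ a.+1 + 1) %/ 4))%N.
Proof.
have [c [h e]] := pshift_expansion a.
have := congr1 (fun f : fps int => f n) e; rewrite fpsMintr {1}/pshift intz => en.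
suff : ((5 ^ a.+1)%N%:Z %| (p_minus 6 (5 ^ a.+1 * n + (3 * 5 ^ a.+1 + 1) %/ 4))%N%:Z)%Z by [].
by rewrite -natz en -natz natrX dvdz_mulr.
Qed.

Lemma pshift_sect_dvd a r n : (r == 2) || (r == 4) ->
  (5 ^ a.+2 %| p_minus 6 (5 ^ a.+1 * (5 * n + r) + (3 * 5 ^ a.+1 + 1) %/ 4))%N.
Proof.
move=> r24; have [c [h e]] := pshift_expansion a; have [k sk] := sect_leading_term r24.
have := congr1 (sect r) e; rewrite sectMz raddfD /= sectMz sect_natM sk.
have -> : (5 ^+ a.+1)%:~R * (c%:~R * (5 * k) + 5 * sect r h)
    = (5 ^+ a.+2)%:~R * (c%:~R * k + sect r h).
  by rewrite [5 ^+ a.+2]exprS rmorphM /=; move: ((5 ^+ a.+1)%:~R) (c%:~R) => u v; ring.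
move/(congr1 (fun f : fps int => f n)); rewrite fpsMintr {1}/sect {1}/pshift intz => en.
suff : ((5 ^ a.+2)%N%:Z
  %| (p_minus 6 (5 ^ a.+1 * (5 * n + r) + (3 * 5 ^ a.+1 + 1) %/ 4))%N%:Z)%Z by [].
by rewrite -natz en -natz natrX dvdz_mulr.
Qed.

Local Close Scope ring_scope.

Theorem theorem1p3 (n alpha : nat) (halpha : 1 <= alpha) :
  [/\ p_minus 6 (5 ^ alpha * n + (3 * 5 ^ alpha + 1) %/ 4)
        = 0 %[mod 5 ^ alpha],
      p_minus 6 (5 ^ alpha.+1 * n + (11 * 5 ^ alpha + 1) %/ 4)
        = 0 %[mod 5 ^ alpha.+1]
    & p_minus 6 (5 ^ alpha.+1 * n + (19 * 5 ^ alpha + 1) %/ 4)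
        = 0 %[mod 5 ^ alpha.+1]].
Proof.
case: alpha halpha => // a _; have m4 := mod4_5X a.+1.
rewrite !mod0n; split; apply/eqP.
- exact: pshift_dvd.
(* The classes 2 and 4 modulo 5 give the other two progressions, as 2 + 3/4 = 11/4 and 4 + 3/4 =
   19/4. *)
- have := @pshift_sect_dvd a 2 n isT; congr (_ %| p_minus 6 _)%N.
  by rewrite [(5 ^ a.+2)%N]expnS; move: (5 ^ a.+1)%N m4 => c; lia.
- have := @pshift_sect_dvd a 4 n isT; congr (_ %| p_minus 6 _)%N.
  by rewrite [(5 ^ a.+2)%N]expnS; move: (5 ^ a.+1)%N m4 => c; lia.
Qed.
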